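(* Let $L$ be a (left) Leibniz algebra of finite dimension $n$ over an arbitrary field $\mathbb{F}$ of characteristic $p\neq 2$, and suppose that $L$ has an abelian subalgebra of codimension two. Then either $L$ is solvable and contains an abelian ideal of codimension $k\leq 2$, or one of the following three situations holds: (1) $L$ is a $3$-step solvable Lie algebra and $L\cong \mathfrak{c}(m)\oplus\mathbb{F}^{n-4}$ for some irreducible $m\in\mathfrak{sl}_2(\mathbb{F})$. Moreover, $L^2=\mathfrak{h}(\mathbb{F})$ is the Heisenberg algebra and $C(L)\cong \mathbb{F}^{n-4}+L^{(2)}$ is the unique abelian ideal of maximal dimension, this dimension being $n-3$. (2) $L$ is an almost simple Lie algebra and $L\cong\mathfrak{d}(m)\oplus\mathbb{F}^{n-3}$ for some $m\in\mathfrak{sl}_2(\mathbb{F})$. Moreover, $C(L)\cong\mathbb{F}^{n-3}$ is the unique abelian ideal of maximal dimension, this dimension being $n-3$. (3) $L$ is a $3$-step solvable algebra whose nilradical $B:=\mathrm{Nil}(L)$ satisfies $B\cong\mathfrak{h}(\mathbb{F})\oplus\mathbb{F}^{n-4}$, and $L\cong\mathfrak{e}(\varphi,\vartheta,v,n)$ (with $B$ in the role of $H=\mathfrak{h}(\mathbb{F})\oplus\mathbb{F}^{n-4}$) for certain $v\in I_L$, $\varphi\in\mathrm{Der}_l(B)$ and a linear map $\vartheta:B\to B$, such that $\varphi$ and $\vartheta$ induce maps $\varphi^*,\vartheta^*:B/C(B)\to B/C(B)$ with $\varphi^*=-\vartheta^*$ and $\varphi^*$ irreducible. Moreover, $C(B)$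 is the unique abelian ideal of $L$ of maximal dimension, this dimension being $n-3$.
   Context: A (left) Leibniz algebra is a vector space $L$ with a bilinear product $[\cdot,\cdot]$ satisfying $[x,[y,z]]=[[x,y],z]+[y,[x,z]]$. A subalgebra or ideal $A$ is abelian if $[A,A]=0$; ideals are two-sided. $I_L$ is the span of all $[x,x]$, $x\in L$ (an ideal with $[I_L,L]=0$; it is zero iff $L$ is a Lie algebra). $C(L)=\{x\in L:[x,L]=[L,x]=0\}$ is the center, $\mathrm{Nil}(L)$ the nilradical, $L^2=[L,L]$, and the derived series is $L^{(0)}=L$, $L^{(k+1)}=[L^{(k)},L^{(k)}]$; $L$ is $k$-step solvable if $L^{(k)}=0\neq L^{(k-1)}$. $\mathbb{F}^k$ denotes the abelian algebra of dimension $k$, and direct sums are direct sums of algebras. $\mathfrak{h}(\mathbb{F})$ is the Heisenberg Lie algebra with basis $x,y,z$ and non-zero products $[x,y]=-[y,x]=z$. A matrix (or linear map) is irreducible if it has no invariant subspace other than $0$ and the whole space; for $m\in\mathfrak{gl}_2(\mathbb{F})$ this means that its characteristic polynomial is irreducible over $\mathbb{F}$. For $\lambda=(\lambda_{ij})\in\mathfrak{gl}_2(\mathbb{F})$: - $\mathfrak{c}(\lambda)$ has basis $a,b,x,y$ and non-zero products $[a,x]=-[x,a]=\lambda_{11}x+\lambda_{12}y$, $[a,y]=-[y,a]=\lambda_{21}x+\lambda_{22}y$, $[x,y]=-[y,x]=b$. - $\mathfrak{d}(\lambda)$ has basis $h,x,y$ and skew-symmetric product given by $[h,x]=\lambda_{11}x+\lambda_{12}y$,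 $[h,y]=\lambda_{21}x+\lambda_{22}y$, $[x,y]=h$. A Lie algebra is called almost simple here if it is the direct sum of a simple Lie algebra and an abelian one; so in (2) the algebra $\mathfrak{d}(m)$ is a $3$-dimensional simple Lie algebra. Let $H=\mathfrak{h}(\mathbb{F})\oplus\mathbb{F}^{n-4}$ with product $[\cdot,\cdot]$. $\mathrm{Der}_l(H)$ is the set of (left) derivations, i.e. linear maps $\varphi:H\to H$ with $\varphi([a,b])=[\varphi(a),b]+[a,\varphi(b)]$. For $v\in C(H)$, $\varphi\in\mathrm{Der}_l(H)$ and a linear map $\vartheta:H\to H$, $\mathfrak{e}(\varphi,\vartheta,v,n)$ denotes the one-dimensional solvable extension of $H$ (a solvable algebra of dimension $\dim H+1=n$ with nilradical $H$) with underlying space $\mathbb{F}x\oplus H$ and product $$[\lambda x+a,\mu x+b]_{\mathfrak{e}}=\lambda\mu v+\lambda\varphi(b)+\mu\vartheta(a)+[a,b],\qquad a,b\in H,\ \lambda,\mu\in\mathbb{F}.$$ *)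

(* Defs.v *)
From HB Require Import structures.
From mathcomp Require Import all_boot all_order all_algebra.

Set Implicit Arguments.
Unset Strict Implicit.
Unset Printing Implicit Defensive.

Import GRing.Theory.
Local Open Scope ring_scope.

(* A finite-dimensional algebra: a vector space with an arbitrary bilinear
   product.  The Leibniz identity is kept separate because c(lambda),
   d(lambda) and e(phi, theta, v, n) need not satisfy it for arbitrary
   parameters. *)
HB.mixin Record Vector_isAlg (F : fieldType) V of Vector F V := {
  br : V -> V -> V;
  br_bilinear : bilinear_for *:%R *:%R br
}.

#[short(type="algebraType")]
HB.structure Definition Alg (F : fieldType) := {V of Vector F V & Vector_isAlg F V}.

Notation "[br x , y ]" := (br x y) (format "[br  x ,  y ]") : ring_scope.

Definition leibniz_identity (F : fieldType) (L : algebraType F) :=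
  forall x y z : L, [br x, [br y, z]] = [br [br x, y], z] + [br y, [br x, z]].

HB.mixin Record Alg_isLeibniz (F : fieldType) L of Alg F L := {
  br_leibniz : @leibniz_identity F L
}.

#[short(type="leibnizType")]
HB.structure Definition Leibniz (F : fieldType) := {L of Alg F L & Alg_isLeibniz F L}.

Section BracketTheory.
Variables (F : fieldType) (L : algebraType F).
Implicit Types x y : L.

Lemma br_linear_l y : linear (fun x => [br x, y]).
Proof. exact: (br_bilinear.1 y). Qed.

Lemma br_linear_r x : linear (br x).
Proof. exact: (br_bilinear.2 x). Qed.

HB.instance Definition _ x := GRing.isLinear.Build F L L *:%R (br x) (br_linear_r x).

Definition brr y x := [br x, y].
HB.instance Definition _ y := GRing.isLinear.Build F L L *:%R (brr y) (br_linear_l y).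

Definition ad_l x : 'End(L) := linfun (br x).
Definition ad_r y : 'End(L) := linfun (brr y).

Lemma ad_lE x y : ad_l x y = [br x, y]. Proof. by rewrite lfunE. Qed.
Lemma ad_rE x y : ad_r y x = [br x, y]. Proof. by rewrite lfunE. Qed.

(* By bilinearity, the products of basis vectors span [U, V]; see brv_sub. *)
Definition brv (U V : {vspace L}) : {vspace L} :=
  <<[seq [br x, y] | x <- vbasis U, y <- vbasis V]>>%VS.

Lemma memv_br (U V : {vspace L}) x y :
  x \in U -> y \in V -> [br x, y] \in brv U V.
Proof.
move=> /coord_vbasis -> /coord_vbasis ->.
rewrite -ad_rE linear_sum memv_suml // => i _.
rewrite linearZ memvZ //= ad_rE linear_sum memv_suml // => j _.
rewrite linearZ memvZ //= memv_span //.
by apply/allpairsP; exists ((vbasis U)`_i, (vbasis V)`_j); rewrite /= !mem_nth ?size_tuple.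
Qed.

Lemma brv_sub (U V W : {vspace L}) :
  reflect (forall x y, x \in U -> y \in V -> [br x, y] \in W) (brv U V <= W)%VS.
Proof.
apply: (iffP idP) => [/subvP sW x y xU yV | sW]; first exact/sW/memv_br.
by apply/span_subvP => _ /allpairsP[[x y] /= [xU yV ->]]; apply: sW; apply: vbasis_mem.
Qed.

Definition subalgebra (A : {vspace L}) := (brv A A <= A)%VS.
Definition ideal (I : {vspace L}) := (brv fullv I <= I)%VS && (brv I fullv <= I)%VS.
Definition abelian (A : {vspace L}) := brv A A == 0%VS.
Definition abelian_ideal (I : {vspace L}) := ideal I && abelian I.

Definition unique_max_abelian_ideal (Z : {vspace L}) :=
  abelian_ideal Z /\
  forall J : {vspace L}, abelian_ideal J ->
    (\dim J <= \dim Z)%N /\ (\dim J = \dim Z -> J = Z).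

Definition center : {vspace L} :=
  (\bigcap_(i < \dim {:L})
     (lker (ad_l (vbasis {:L})`_i) :&: lker (ad_r (vbasis {:L})`_i)))%VS.

Lemma centerP x :
  reflect (forall y, [br x, y] = 0 /\ [br y, x] = 0) (x \in center).
Proof.
rewrite memvE; apply: (iffP subv_bigcapP) => [xZ y | xZ i _].
  have key i : [br x, (vbasis {:L})`_i] = 0 /\ [br (vbasis {:L})`_i, x] = 0.
    case: (ltnP i (\dim {:L})) => [lti | lei].
      have /subvP/(_ x (memv_line x)) := xZ (Ordinal lti) isT.
      by rewrite memv_cap !memv_ker ad_lE ad_rE => /andP[/eqP-> /eqP->].
    rewrite nth_default ?size_tuple //.
    by rewrite -ad_lE -[[br 0, x]]ad_rE !linear0.
  rewrite (coord_vbasis (memvf y)) -ad_lE -[[br _ , x]]ad_rE !linear_sum /=.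
  by split; rewrite big1 // => i _; rewrite linearZ /= ?ad_lE ?ad_rE;
    have [e1 e2] := key i; rewrite ?e1 ?e2 scaler0.
rewrite -memvE memv_cap !memv_ker ad_lE ad_rE.
by have [-> ->] := xZ (vbasis {:L})`_i; rewrite eqxx.
Qed.

(* x lies in I_L, the span of all squares. *)
Definition in_leibniz_kernel x :=
  exists s : seq L, x \in <<[seq [br y, y] | y <- s]>>%VS.

Fixpoint derived (k : nat) : {vspace L} :=
  if k is k'.+1 then brv (derived k') (derived k') else fullv.

Definition solvable := exists k, derived k = 0%VS.

Definition step_solvable (k : nat) := derived k = 0%VS /\ derived k.-1 <> 0%VS.

(* In a left Leibniz algebra the right-normed products span all products of
   a given length, so this is the usual descending central series of N. *)
Fixpoint lcs (N : {vspace L}) (k : nat) : {vspace L} :=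
  if k is k'.+1 then brv N (lcs N k') else N.

Definition nilpotent (N : {vspace L}) := exists k, lcs N k = 0%VS.

Definition is_nilradical (N : {vspace L}) :=
  [/\ ideal N, nilpotent N &
      forall J : {vspace L}, ideal J -> nilpotent J -> (J <= N)%VS].

Definition left_derivation (phi : 'End(L)) :=
  forall a b, phi [br a, b] = [br phi a, b] + [br a, phi b].

Definition is_lie := leibniz_identity L /\ forall x, [br x, x] = 0.

Definition simple_lie :=
  [/\ is_lie, ~~ abelian fullv &
      forall I : {vspace L}, ideal I -> I = 0%VS \/ I = fullv].

End BracketTheory.

Arguments center {F} L.
Arguments derived {F} L k.
Arguments solvable {F} L.
Arguments step_solvable {F} L k.
Arguments is_lie {F} L.
Arguments simple_lie {F} L.

Definition is_alg_iso (F : fieldType) (L M : algebraType F) (f : 'Hom(L, M)) :=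
  bijective f /\ forall x y, f [br x, y] = [br f x, f y].

Definition isomorphic (F : fieldType) (L M : algebraType F) :=
  exists f : 'Hom(L, M), is_alg_iso f.

(* Direct sum of algebras, on the product type L * M. *)
Section DirectSum.
Variables (F : fieldType) (L M : algebraType F).

Definition dsum_br (u v : L * M) : L * M := ([br u.1, v.1], [br u.2, v.2]).

Lemma dsum_br_bilinear : bilinear_for *:%R *:%R dsum_br.
Proof.
split=> w a u v; apply: injective_projections => /=;
  by [exact: br_linear_l | exact: br_linear_r].
Qed.

HB.instance Definition _ := Vector_isAlg.Build F (L * M)%type dsum_br_bilinear.

Definition dsum_inr (w : M) : L * M := (0, w).

Lemma dsum_inr_linear : linear dsum_inr.
Proof. by move=> a u v; apply: injective_projections => //=; rewrite scaler0 addr0. Qed.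

HB.instance Definition _ := GRing.isLinear.Build F M (L * M)%type *:%R dsum_inr dsum_inr_linear.

End DirectSum.

(* The product induced on a subspace U: the product of L followed by the
   projection onto U, i.e. the restriction of the product when U is a
   subalgebra (sub_brE). *)
Section SubAlgebra.
Variables (F : fieldType) (L : algebraType F) (U : {vspace L}).

Definition sub_br (u v : subvs_of U) : subvs_of U := vsproj U [br vsval u, vsval v].

Lemma sub_br_bilinear : bilinear_for *:%R *:%R sub_br.
Proof.
by split=> w a u v; rewrite /= /sub_br linearP ?(br_linear_l (vsval w))
  ?(br_linear_r (vsval w)) linearP.
Qed.

HB.instance Definition _ := Vector_isAlg.Build F (subvs_of U) sub_br_bilinear.

Lemma sub_brE (u v : subvs_of U) :
  subalgebra U -> vsval [br u, v] = [br vsval u, vsval v].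
Proof. by move=> /brv_sub sU; rewrite vsprojK // sU ?subvsP. Qed.

End SubAlgebra.

(* The algebra with basis e_0, ..., e_(n-1) and [e_i, e_j] = T i j. *)
Definition table_alg (F : fieldType) (n : nat) (T : nat -> nat -> 'rV[F]_n) : Type :=
  'rV[F]_n.

Section TableAlgebra.
Variables (F : fieldType) (n : nat) (T : nat -> nat -> 'rV[F]_n).

HB.instance Definition _ := Vector.on (table_alg T).

Definition table_br (u v : table_alg T) : table_alg T :=
  \sum_(i < n) \sum_(j < n) ((u : 'rV[F]_n) 0 i * (v : 'rV[F]_n) 0 j) *: T i j.

Lemma table_br_bilinear : bilinear_for *:%R *:%R table_br.
Proof.
split=> w a u v; rewrite /= /table_br; pose S := 'rV[F]_n.
  rewrite -[RHS]/(a *: (_ : S) + (_ : S)) scaler_sumr -big_split; apply: eq_bigr => i _.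
  rewrite scaler_sumr -big_split; apply: eq_bigr => j _.
  by rewrite !mxE /= scalerA -scalerDl mulrDl mulrA.
rewrite -[RHS]/(a *: (_ : S) + (_ : S)) scaler_sumr -big_split; apply: eq_bigr => i _.
rewrite scaler_sumr -big_split; apply: eq_bigr => j _.
by rewrite !mxE /= scalerA -scalerDl mulrDr mulrCA.
Qed.

HB.instance Definition _ := Vector_isAlg.Build F (table_alg T) table_br_bilinear.

End TableAlgebra.

Section Models.
Variable F : fieldType.

Definition abelian_alg (k : nat) : algebraType F := table_alg (fun _ _ => 0 : 'rV[F]_k).

Let e n (i : 'I_n) : 'rV[F]_n := delta_mx 0 i.

(* Basis x, y, z, numbered 0, 1, 2. *)
Definition heis_table (i j : nat) : 'rV[F]_3 :=
  let z := e (inord 2 : 'I_3) in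
  match i, j with
  | 0%N, 1%N => z
  | 1%N, 0%N => - z
  | _, _ => 0
  end.

Definition heisenberg : algebraType F := table_alg heis_table.

Variable lambda : 'M[F]_2.
Let l11 := lambda ord0 ord0.
Let l12 := lambda ord0 ord_max.
Let l21 := lambda ord_max ord0.
Let l22 := lambda ord_max ord_max.

(* Basis a, b, x, y, numbered 0, 1, 2, 3. *)
Definition c_table (i j : nat) : 'rV[F]_4 :=
  let b := e (inord 1 : 'I_4) in
  let x := e (inord 2 : 'I_4) in
  let y := e (inord 3 : 'I_4) in
  match i, j with
  | 0%N, 2%N => l11 *: x + l12 *: y
  | 2%N, 0%N => - (l11 *: x + l12 *: y)
  | 0%N, 3%N => l21 *: x + l22 *: y
  | 3%N, 0%N => - (l21 *: x + l22 *: y)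
  | 2%N, 3%N => b
  | 3%N, 2%N => - b
  | _, _ => 0
  end.

Definition c_alg : algebraType F := table_alg c_table.

(* Basis h, x, y, numbered 0, 1, 2. *)
Definition d_table (i j : nat) : 'rV[F]_3 :=
  let h := e (inord 0 : 'I_3) in
  let x := e (inord 1 : 'I_3) in
  let y := e (inord 2 : 'I_3) in
  match i, j with
  | 0%N, 1%N => l11 *: x + l12 *: y
  | 1%N, 0%N => - (l11 *: x + l12 *: y)
  | 0%N, 2%N => l21 *: x + l22 *: y
  | 2%N, 0%N => - (l21 *: x + l22 *: y)
  | 1%N, 2%N => h
  | 2%N, 1%N => - h
  | _, _ => 0
  end.

Definition d_alg : algebraType F := table_alg d_table.

End Models.

Definition almost_simple (F : fieldType) (L : algebraType F) :=
  exists (S : algebraType F) (k : nat),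
    simple_lie S /\ isomorphic L (S * abelian_alg F k)%type.

(* e(phi, theta, v, n) on F x + H: the pair (l, a) stands for l x + a. *)
Definition ext_alg (F : fieldType) (H : algebraType F) (phi theta : 'End(H)) (v : H) : Type :=
  (F^o * H)%type.

Section Extension.
Variables (F : fieldType) (H : algebraType F) (phi theta : 'End(H)) (v : H).

HB.instance Definition _ := Vector.on (ext_alg phi theta v).

Definition ext_br (s t : ext_alg phi theta v) : ext_alg phi theta v :=
  let l : F := s.1 in let m : F := t.1 in
  (0, (l * m) *: v + l *: phi t.2 + m *: theta s.2 + [br s.2, t.2]).

Lemma ext_br_bilinear : bilinear_for *:%R *:%R ext_br.
Proof.
split=> w c [l1 a1] [l2 a2]; case: w => m b;
  apply: injective_projections => /=; rewrite ?scaler0 ?addr0 //;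
  rewrite ?(br_linear_l b) ?(br_linear_r b) !linearP -[c *: l1]/((c : F) * l1);
  rewrite ?mulrDl ?mulrDr !scalerDl !scalerDr !scalerA -?mulrA ?(mulrC m) ?mulrA;
  rewrite ?addrA.
  by rewrite [RHS](ACl (1*5*2*6*3*7*4*8)%AC).
by rewrite [RHS](ACl (1*5*2*6*3*7*4*8)%AC).
Qed.

HB.instance Definition _ := Vector_isAlg.Build F (ext_alg phi theta v) ext_br_bilinear.

End Extension.

(* MathComp has no quotient vector spaces; V / U is carried by the complement
   U^C, with canonical projection the projection onto U^C along U. *)
Section Quotient.
Variables (F : fieldType) (V : vectType F) (U : {vspace V}).

Definition quotv : vectType F := subvs_of U^C.

Definition quotv_pi : 'Hom(V, quotv) :=
  (linfun (vsproj U^C) \o (\1 - projv U))%VF.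

Lemma quotv_piE x : vsval (quotv_pi x) = x - projv U x.
Proof.
by rewrite comp_lfunE !lfunE /= opp_lfunE id_lfunE vsprojK ?memv_projC.
Qed.

Lemma lker_quotv_pi : lker quotv_pi = U.
Proof.
apply/vspaceP => x; rewrite memv_ker -(inj_eq subvs_inj) quotv_piE linear0 subr_eq0.
by apply/eqP/idP => [-> | /projv_id->]; rewrite ?memv_proj.
Qed.

Lemma limg_quotv_pi : limg quotv_pi = fullv.
Proof.
apply/vspaceP => w; rewrite memvf; apply/memv_imgP; exists (vsval w); rewrite ?memvf //.
apply: subvs_inj; rewrite quotv_piE; suff ->: projv U (vsval w) = 0 by rewrite subr0.
by apply/eqP; rewrite -memv_ker lker_proj subvsP.
Qed.

Definition induces (f : 'End(V)) (fq : 'End(quotv)) :=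
  forall x, fq (quotv_pi x) = quotv_pi (f x).

End Quotient.

Definition irreducible_map (F : fieldType) (V : vectType F) (f : 'End(V)) :=
  forall W : {vspace V}, (f @: W <= W)%VS -> W = 0%VS \/ W = fullv.

Definition irreducible_mx (F : fieldType) (n : nat) (m : 'M[F]_n) :=
  irreducible_map (linfun (mulmxr m) : 'End('rV[F]_n)).

(* Main.v *)
(* Let A be the abelian subalgebra and V = L / A, a plane on which A acts by the
   left and right multiplications l_a and r_a.  The l_a commute with each other
   and with the r_a, r_b r_a = - l_a r_b, and all [x, y] + [y, x] annihilate L
   from the left.

   If some l_a is invertible on V, then W = l_a(L) is an A-invariant complement
   of A.  Either r = - l on W, so that L is a Lie algebra, and for x, y spanning
   W the element [x, y] lies in A; if it is non-zero, then A acts on W through a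
   line of traceless maps, and [x, y] acts on W invertibly (type (2)) or
   trivially (Heisenberg situation).  Or some non-zero w in W satisfies
   [w, L] = 0, and an abelian ideal of codimension at most 2 is built from W
   and the kernel of the action.

   If every l_a is singular on V, then l_A is spanned on V by 0, by an
   idempotent, or by a nilpotent m.  Only the last case, with x = [a, y],
   u = [a, x] non-zero and r = - l on x, escapes the abelian ideals: modulo the
   kernel A0 of the action u is a multiple t a of a, where t <> 0 gives type (2)
   and t = 0 the Heisenberg situation.

   In the Heisenberg situation B is an ideal of codimension 1 with a central
   subspace Z of codimension 2 such that [B, B] <= Z, and a line of B / Z
   invariant under the outer derivation gives an abelian ideal of codimension 2;
   if there is none, L is of type (3).  Algebras of type (1) are also of type
   (3), with phi = ad a and v = 0, so (1) need not be singled out. *)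

From HB Require Import structures.
Require Import Defs.
From mathcomp Require Import all_boot all_order all_algebra.
From mathcomp Require Import ring.
From Stdlib Require Import Classical.

Set Implicit Arguments.
Unset Strict Implicit.
Unset Printing Implicit Defensive.

Import GRing.Theory VectorInternalTheory.
Local Open Scope ring_scope.

(** * Linear algebra *)

Section Coordinates.
Variables (F : fieldType) (V : vectType F).
Implicit Types (u v w : V) (U W : {vspace V}).

(** Coordinates turn a vector identity into one identity in [F] per index, which [ring] decides;
    [vring] packages this. *)
Definition coordv (i : 'I_(dim V)) v : F := v2r v 0 i.

Lemma coordvD i u v : coordv i (u + v) = coordv i u + coordv i v.
Proof. by rewrite /coordv linearD mxE. Qed.
Lemma coordvN i u : coordv i (- u) = - coordv i u.
Proof. by rewrite /coordv linearN mxE. Qed.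
Lemma coordvZ i a u : coordv i (a *: u) = a * coordv i u.
Proof. by rewrite /coordv linearZ mxE. Qed.
Lemma coordv0 i : coordv i 0 = 0.
Proof. by rewrite /coordv linear0 mxE. Qed.

Lemma coordvP u v : (forall i, coordv i u = coordv i v) -> u = v.
Proof. by move=> uv; apply: (can_inj v2rK); apply/rowP => i; apply: uv. Qed.

Definition coordvE := (coordvD, coordvN, coordvZ, coordv0).

(** Reasoning from a single relation [u = v]: once the multiplier [a] is chosen, [vring] closes the
    identity that remains. *)
Lemma lincomb1 a u v x y : u = v -> x - y = a *: (u - v) -> x = y.
Proof. by move=> -> /eqP; rewrite subrr scaler0 subr_eq0 => /eqP. Qed.

End Coordinates.

Ltac vring := apply: coordvP => ?; rewrite ?coordvE; ring.

Lemma memv_opp (F : fieldType) (V : vectType F) (U : {vspace V}) v : v \in U -> - v \in U.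
Proof. by rewrite memvN. Qed.

Lemma memv_eq (F : fieldType) (V : vectType F) (U : {vspace V}) u v :
  v \in U -> u = v -> u \in U.
Proof. by move=> vU ->. Qed.

Section AddLine.
Variables (F : fieldType) (V : vectType F) (U : {vspace V}).
Lemma mem_addl z u : u \in U -> u \in (U + <[z]>)%VS.
Proof. by move=> uU; apply: subvP uU; apply: addvSl. Qed.
Lemma mem_addr z : z \in (U + <[z]>)%VS.
Proof. by apply: subvP (memv_line z); apply: addvSr. Qed.
End AddLine.

Ltac memv_auto := repeat first
  [ assumption | exact: mem0v | exact: mem_addr | apply: mem_addl; assumption | apply: memvD | apply: memvB | apply: memv_opp
  | apply: memvZ | exact: memv_line ].

Section Subspaces.
Variables (F : fieldType) (V : vectType F).
Implicit Types (u v w : V) (U W : {vspace V}).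

Lemma memv_scaleE U a v : a != 0 -> (a *: v \in U) = (v \in U).
Proof.
move=> a0; apply/idP/idP => [avU|]; last exact: memvZ.
by rewrite -[v](scalerK a0) memvZ.
Qed.

Lemma scaleK0 U a v : a *: v \in U -> v \notin U -> a = 0.
Proof. by move=> avU vU; apply: contraNeq vU => /memv_scaleE <-. Qed.

Lemma memv_add_lineP U w v :
  reflect (exists a, v - a *: w \in U) (v \in (U + <[w]>)%VS).
Proof.
apply: (iffP memv_addP) => [[u uU [_ /vlineP[a ->] ->]] | [a vU]].
  by exists a; rewrite addrK.
by exists (v - a *: w) => //; exists (a *: w); rewrite ?memvZ ?memv_line ?subrK.
Qed.

Lemma dim_add_line U w : w \notin U -> \dim (U + <[w]>) = (\dim U).+1.
Proof.
move=> wU; rewrite dimv_disjoint_sum ?dim_vline.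
  by rewrite (_ : w != 0) ?addn1 //; apply: contraNneq wU => ->; rewrite mem0v.
apply/eqP; rewrite -subv0; apply/subvP => v /memv_capP[vU /vlineP[a va]].
by move: vU; rewrite va memv0 => /scaleK0/(_ wU) ->; rewrite scale0r.
Qed.

Lemma codim_cap_lker (W : vectType F) (f : 'Hom(V, W)) U (X : {vspace W}) :
  (forall u, u \in U -> f u \in X) -> (\dim U <= \dim (U :&: lker f) + \dim X)%N.
Proof.
move=> fX; rewrite -(limg_ker_dim f U) leq_add2l dimvS //.
by apply/subvP => _ /memv_imgP[u uU ->]; apply: fX.
Qed.

Lemma span1 U W w : (U <= W)%VS -> w \in W -> w \notin U -> (\dim W <= (\dim U).+1)%N ->
  forall v, v \in W -> exists a, exists2 u, u \in U & v = a *: w + u.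
Proof.
move=> UW wW wU dW v vW; have: v \in (U + <[w]>)%VS.
  suff /eqP-> : (U + <[w]>)%VS == W by [].
  by rewrite eqEdim dim_add_line // dW andbT subv_add UW -memvE.
by case/memv_add_lineP=> a aU; exists a, (v - a *: w); rewrite // addrC subrK.
Qed.

(** Linear independence of [x] and [y] modulo [U]. *)
Definition free2 U x y := forall a b, a *: x + b *: y \in U -> a = 0 /\ b = 0.

Lemma free2_dim U x y : free2 U x y -> \dim (U + <[x]> + <[y]>) = (\dim U).+2.
Proof.
move=> fr; rewrite !dim_add_line //.
  by apply/negP => xU; case: (fr 1 0); [rewrite scale1r scale0r addr0 | move/eqP; rewrite oner_eq0].
apply/memv_add_lineP => -[a yU].
case: (fr (- a) 1); first by rewrite scale1r addrC scaleNr.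
by move=> _ /eqP; rewrite oner_eq0.
Qed.

Lemma span2 U W x y : (U <= W)%VS -> x \in W -> y \in W -> free2 U x y ->
  (\dim W <= (\dim U).+2)%N -> forall v, v \in W -> exists a b, exists2 u, u \in U & v = a *: x + b *: y + u.
Proof.
move=> UW xW yW fr dW v vW.
have: v \in (U + <[x]> + <[y]>)%VS.
  suff /eqP-> : (U + <[x]> + <[y]>)%VS == W by [].
  by rewrite eqEdim free2_dim // dW andbT !subv_add UW -!memvE xW.
case/memv_add_lineP => b /memv_add_lineP[a abv].
by exists a, b, (v - b *: y - a *: x) => //; vring.
Qed.

End Subspaces.

(** * Brackets and ideals *)

Section Brackets.
Variables (F : fieldType) (L : algebraType F).
Implicit Types (x y z u v w : L).

Lemma brDl x y z : [br x + y, z] = [br x, z] + [br y, z].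
Proof. by have := br_linear_l z 1 x y; rewrite !scale1r. Qed.
Lemma brDr x y z : [br x, y + z] = [br x, y] + [br x, z].
Proof. exact: linearD. Qed.
Lemma brZl a x y : [br a *: x, y] = a *: [br x, y].
Proof. by rewrite -!ad_rE linearZ. Qed.
Lemma brZr a x y : [br x, a *: y] = a *: [br x, y].
Proof. by rewrite -!ad_lE linearZ. Qed.
Lemma brNl x y : [br - x, y] = - [br x, y].
Proof. by rewrite -!ad_rE linearN. Qed.
Lemma brNr x y : [br x, - y] = - [br x, y].
Proof. by rewrite -!ad_lE linearN. Qed.
Lemma br0l x : [br 0, x] = 0.
Proof. by rewrite -ad_rE linear0. Qed.
Lemma br0r x : [br x, 0] = 0.
Proof. by rewrite -ad_lE linear0. Qed.

Lemma br_suml (I : finType) (E : I -> L) y : [br \sum_i E i, y] = \sum_i [br E i, y].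
Proof. by rewrite -ad_rE linear_sum; apply: eq_bigr => i _ /=; rewrite ad_rE. Qed.
Lemma br_sumr (I : finType) (E : I -> L) x : [br x, \sum_i E i] = \sum_i [br x, E i].
Proof. by rewrite -ad_lE linear_sum; apply: eq_bigr => i _ /=; rewrite ad_lE. Qed.

Definition brE := (brDl, brDr, brNl, brNr, brZl, brZr, br0l, br0r).

Lemma idealP (J : {vspace L}) :
  reflect (forall v j, j \in J -> [br v, j] \in J /\ [br j, v] \in J) (ideal J).
Proof.
apply: (iffP andP) => [[/brv_sub lJ /brv_sub rJ] v j jJ | Jid].
  by rewrite lJ ?rJ ?memvf.
by split; apply/brv_sub => x y xJ yJ; [case: (Jid x y) | case: (Jid y x)].
Qed.

Lemma abelianP (A : {vspace L}) :
  reflect {in A &, forall x y, [br x, y] = 0} (abelian A).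
Proof.
rewrite /abelian -subv0; apply: (iffP (brv_sub _ _ _)) => ab x y xA yA.
  by apply/eqP; rewrite -memv0 ab.
by rewrite memv0 ab.
Qed.

Lemma brv_mono (U U' W W' : {vspace L}) : (U <= U')%VS -> (W <= W')%VS ->
  (brv U W <= brv U' W')%VS.
Proof.
by move=> /subvP sU /subvP sW; apply/brv_sub => x y /sU xU /sW yW; apply: memv_br.
Qed.

End Brackets.

Section Leibniz.
Variables (F : fieldType) (L : leibnizType F).
Implicit Types (x y z : L).

Lemma leib x y z : [br x, [br y, z]] = [br [br x, y], z] + [br y, [br x, z]].
Proof. exact: br_leibniz. Qed.

Lemma leib_l x y z : [br [br x, y], z] = [br x, [br y, z]] - [br y, [br x, z]].
Proof. by rewrite leib addrK. Qed.

(** Left multiplication by [[br x, y]] is the commutator of the left multiplications by [x] and [y],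
    and commutators are skew. *)
Lemma br_symm_kill x y z : [br [br x, y] + [br y, x], z] = 0.
Proof. by rewrite brDl !leib_l addrA subrK subrr. Qed.

Lemma br_sq_kill x z : [br [br x, x], z] = 0.
Proof. by rewrite leib_l subrr. Qed.

End Leibniz.

(** * Solvability from an abelian ideal of codimension at most two *)

Definition small_abelian_ideal (F : fieldType) (L : leibnizType F) (n : nat) :=
  solvable L /\
  exists (I : {vspace L}) (k : nat),
    [/\ abelian_ideal I, (\dim I + k = n)%N & (k <= 2)%N].

Section SmallIdeal.
Variables (F : fieldType) (L : leibnizType F).
Implicit Types (x y z : L) (J : {vspace L}).

(** If [[br z, z] = c *: z + j] with [c] non-zero, right multiplication by [z] kills the left side
    and expresses [[br z, z]] through [[br j, z]]. *)
Lemma sq_in_ideal J z : ideal J -> [br z, z] \in (J + <[z]>)%VS -> [br z, z] \in J.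
Proof.
move=> /idealP Jid /memv_add_lineP[c zzJ].
have [j jJ zzE] : exists2 j, j \in J & [br z, z] = c *: z + j.
  by exists ([br z, z] - c *: z); rewrite // addrC subrK.
case: (eqVneq c 0) => [c0|c0]; first by rewrite zzE c0 scale0r add0r.
rewrite -(memv_scaleE _ _ c0) (_ : _ *: _ = - [br j, z]).
  by rewrite memvN; case: (Jid z _ jJ).
have e := br_sq_kill z z; rewrite zzE brDl brZl in e.
by apply/eqP; rewrite -addr_eq0 e.
Qed.

Lemma codim2_span J : (\dim {:L} <= \dim J + 2)%N ->
  exists p q, forall v, exists a b, exists2 j, j \in J & v = a *: p + b *: q + j.
Proof.
move=> dJ; case: (boolP ({:L} <= J)%VS) => [/subvP fJ | /subvPn[p _ pJ]].
  by exists 0, 0 => v; exists 0, 0, v; rewrite ?fJ ?memvf // !scale0r !add0r.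
case: (boolP ({:L} <= J + <[p]>)%VS) => [/subvP fJ | /subvPn[q _ qJ]].
  exists p, 0 => v; have /memv_add_lineP[a av] := fJ v (memvf v).
  by exists a, 0, (v - a *: p); rewrite // scale0r addr0 addrC subrK.
exists p, q => v; suff: v \in (J + <[p]> + <[q]>)%VS.
  case/memv_add_lineP => b /memv_add_lineP[a abv].
  by exists a, b, (v - b *: q - a *: p) => //; vring.
suff /eqP-> : (J + <[p]> + <[q]>)%VS == fullv by rewrite memvf.
by rewrite eqEdim subvf !dim_add_line //=; move: dJ; rewrite addn2.
Qed.

(** In [L / J], of dimension at most two, the derived algebra has dimension at most one. If a square
    [z = [br p, p]] survives modulo [J], then [p, z] is a basis of the quotient and [z] spans;
    otherwise the quotient product is alternating and [[br p, q]] spans. *)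
Lemma derived1_codim1 J : ideal J -> (\dim {:L} <= \dim J + 2)%N ->
  exists z, (derived L 1 <= J + <[z]>)%VS.
Proof.
move=> Jid dJ; have /idealP JI := Jid.
have lJ v j : j \in J -> [br v, j] \in J by case/(JI v).
have rJ v j : j \in J -> [br j, v] \in J by case/(JI v).
have mJ z x : x \in J -> x \in (J + <[z]>)%VS by move=> xJ; apply: subvP xJ; apply: addvSl.
have mz z : z \in (J + <[z]>)%VS by apply: subvP (memv_line z); apply: addvSr.
have [[p /negP zJ] | sqJ] := classic (exists p, ~ [br p, p] \in J).
  exists [br p, p]; set z := [br p, p] in zJ *.
  have zl v : [br z, v] = 0 by apply: br_sq_kill.
  have fr : free2 J p z.
    move=> a b abJ; have [a0|a0] := eqVneq a 0.
      by move: abJ; rewrite a0 scale0r add0r => /scaleK0 /(_ zJ).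
    case/negP: zJ; apply: sq_in_ideal => //; apply/memv_add_lineP.
    case: (eqVneq b 0) abJ => [->|b0 abJ].
      rewrite scale0r addr0 memv_scaleE // => pJ; exists 0; rewrite scale0r subr0; exact: lJ.
    exists (- a / b); rewrite -(memv_scaleE _ _ b0) -/z.
    by rewrite (_ : _ *: _ = a *: p + b *: z) //; apply: coordvP => i; rewrite !coordvE; field.
  have sp v := span2 (subvf J) (memvf p) (memvf z) fr (leq_trans dJ (eq_leq (addn2 _))) (memvf v).
  have pz : [br p, z] \in (J + <[z]>)%VS.
    have [a [b [j jJ pzE]]] := sp [br p, z].
    (* Multiply [[br p, z]] by [p] on the right: the result is zero because [z] annihilates [L] from
       the left, while the coefficient [a] contributes [a *: z]. *)
    have a0 : a = 0.
      apply: (scaleK0 (v := z) (U := J)) zJ; rewrite (_ : _ *: _ = - [br j, p]).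
        by rewrite memvN rJ.
      have e : [br [br p, z], p] = 0 by rewrite leib_l zl br0r sub0r -/z zl oppr0.
      by apply/eqP; rewrite pzE !brE zl scaler0 addr0 in e; rewrite -addr_eq0 e.
    by rewrite pzE a0 scale0r add0r; memv_auto; auto.
  apply/brv_sub => x y _ _.
  have [a [b [j jJ ->]]] := sp x; have [a' [b' [j' jJ' ->]]] := sp y.
  rewrite !brE !zl -/z; memv_auto; auto.
have {}sqJ p : [br p, p] \in J by apply/negPn/negP => pJ; apply: sqJ; exists p; apply/negP.
have [p [q sp]] := codim2_span dJ; exists [br p, q].
have qp : [br q, p] \in (J + <[[br p, q]]>)%VS.
  have -> : [br q, p] = [br p + q, p + q] - [br p, p] - [br q, q] - [br p, q].
    by rewrite !brE; vring.
  by memv_auto; auto.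
apply/brv_sub => x y _ _.
have [a [b [j jJ ->]]] := sp x; have [a' [b' [j' jJ' ->]]] := sp y.
rewrite !brE; memv_auto; auto.
Qed.

(** [L^2] lies in [J] plus the line of some [z], and [[br z, z]] falls into [J] by [sq_in_ideal]. So
    [L^(2)] lies in [J], and the next derived term is zero. *)
Lemma small_abelian_idealI J n : \dim {:L} = n -> ideal J -> abelian J -> (n <= \dim J + 2)%N ->
  small_abelian_ideal L n.
Proof.
move=> dL Jid Jab dJ; have dJn : (\dim J <= n)%N by rewrite -dL dimvS ?subvf.
split; last first.
  by exists J, (n - \dim J)%N; split; [rewrite /abelian_ideal Jid | rewrite subnKC | rewrite leq_subLR].
rewrite -dL in dJ; have [z dz] := derived1_codim1 Jid dJ.
have /idealP JI := Jid.
have lJ v j : j \in J -> [br v, j] \in J by case/(JI v).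
have rJ v j : j \in J -> [br j, v] \in J by case/(JI v).
have zz : [br z, z] \in J by apply: sq_in_ideal => //; apply: subvP dz _ _; rewrite memv_br ?memvf.
exists 3; apply/eqP; rewrite -subv0 -(eqP Jab).
suff d2 : (derived L 2 <= J)%VS by apply: brv_mono.
apply/brv_sub => x y /(subvP dz)/memv_add_lineP[a xJ] /(subvP dz)/memv_add_lineP[b yJ].
rewrite -(subrK (a *: z) x) -(subrK (b *: z) y).
by move: (x - _) (y - _) xJ yJ => {}x {}y xJ yJ; rewrite !brE; memv_auto; auto.
Qed.
End SmallIdeal.

(** * Algebras given by a multiplication table *)

Section Isomorphisms.
Variable F : fieldType.

Lemma dim_dsum_table (n k : nat) (T : nat -> nat -> 'rV[F]_n) :
  \dim {:(table_alg T * abelian_alg F k)%type} = (n + k)%N.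
Proof.
rewrite dimvf -[LHS]/(1 * n + 1 * k)%N. by rewrite !mul1n. Qed.

Lemma inj_lfun_bij (V W : vectType F) (f : 'Hom(V, W)) :
  (forall v, f v = 0 -> v = 0) -> \dim {:V} = \dim {:W} -> bijective f.
Proof.
move=> f0 dVW; have kf : lker f == 0%VS.
  by rewrite -subv0; apply/subvP => v; rewrite memv_ker memv0 => /eqP/f0->.
exists (f^-1)%VF; first exact: lker0_lfunK.
move=> w; apply: limg_lfunVK; suff /eqP-> : limg f == fullv by rewrite memvf.
by rewrite eqEdim subvf -dVW -(limg_ker_dim f fullv) (eqP kf) capv0 dimv0 add0n leqnn.
Qed.

Lemma isomorphic_sym (L M : algebraType F) : isomorphic L M -> isomorphic M L.
Proof.
case=> f [[g fK gK] fM]; have kf : lker f == 0%VS by apply/lker0P/(can_inj fK).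
have f'E w : (f^-1)%VF w = g w by rewrite -{1}(gK w) lker0_lfunK.
exists (f^-1)%VF; split; first by exists f => x; rewrite f'E.
by move=> x y; rewrite !f'E; apply: (can_inj fK); rewrite fM !gK.
Qed.

Section TableIso.
Variables (L : algebraType F) (n k : nat) (T : nat -> nat -> 'rV[F]_n).
Variables (X : 'I_n -> L) (Z : {vspace L}).
Hypotheses (dZ : \dim Z = k) (dL : \dim {:L} = (n + k)%N).
Hypothesis X_free : forall r : 'rV[F]_n, \sum_i r 0 i *: X i \in Z -> r = 0.
Hypothesis Zc : forall z, z \in Z -> forall v, [br z, v] = 0 /\ [br v, z] = 0.
Hypothesis XT : forall i j : 'I_n, [br X i, X j] = \sum_l T i j 0 l *: X l.

Definition table_fun (p : (table_alg T * abelian_alg F k)%type) : L :=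
  \sum_i (p.1 : 'rV[F]_n) 0 i *: X i + \sum_(j < k) (p.2 : 'rV[F]_k) 0 j *: (vbasis Z)`_j.

Lemma table_fun_linear : linear table_fun.
Proof.
move=> a [u1 u2] [v1 v2]; rewrite /table_fun /=.
rewrite scalerDr !scaler_sumr addrACA -!big_split /=.
by congr (_ + _); apply: eq_bigr => i _; rewrite !mxE scalerDl scalerA.
Qed.

HB.instance Definition _ := GRing.isLinear.Build _ _ _ _ table_fun table_fun_linear.

(** Recognition of a direct sum: the [X i] span a copy of the table algebra, and the annihilating
    subspace [Z] supplies the abelian summand. *)
Lemma table_iso : exists f : 'Hom((table_alg T * abelian_alg F k)%type, L),
  is_alg_iso f /\ forall r, f (r, 0) = \sum_i (r : 'rV[F]_n) 0 i *: X i.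
Proof.
have Z2 (s : 'rV[F]_k) : \sum_(j < k) s 0 j *: (vbasis Z)`_j \in Z.
  by apply: memv_suml => j _; rewrite memvZ // vbasis_mem // mem_nth // size_tuple dZ.
exists (linfun table_fun); split; [split|].
- apply: inj_lfun_bij; last by rewrite dim_dsum_table dL.
  case=> r s; rewrite lfunE /= /table_fun /= => /eqP f0.
  have r0 : r = 0.
    by apply: X_free; move: f0; rewrite addr_eq0 => /eqP->; rewrite memvN Z2.
  move: f0; rewrite r0 big1 ?add0r => [/eqP s0|i _]; last by rewrite mxE scale0r.
  have /freeP fr := basis_free (vbasisP Z).
  congr pair; apply/rowP => j; rewrite mxE.
  move: s s0 j; rewrite -dZ => s s0 j; exact: fr.
- move=> [r s] [r' s']; rewrite !lfunE /= /table_fun /=.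
  set z := (X in _ = [br _ + X, _]); set z' := (X in _ = [br _, _ + X]).
  rewrite brDl !brDr !(proj1 (Zc (Z2 _) _), proj2 (Zc (Z2 _) _)) !addr0.
  have ss0 j : ([br s, s'] : 'rV[F]_k) 0 j = 0.
    by rewrite summxE big1 // => i _; rewrite summxE big1 // => l _; rewrite scaler0 mxE.
  rewrite [X in _ + X]big1 ?addr0 => [|j _]; last by rewrite ss0 scale0r.
  rewrite br_suml; under [RHS]eq_bigr => i _ do rewrite brZl br_sumr scaler_sumr.
  under [RHS]eq_bigr => i _ do under eq_bigr => j _ do
    rewrite brZr XT scalerA scaler_sumr.
  under eq_bigr => l _ do rewrite summxE scaler_suml.
  rewrite exchange_big; apply: eq_bigr => i _.
  under eq_bigr => l _ do rewrite summxE scaler_suml.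
  rewrite exchange_big; apply: eq_bigr => j _.
  by apply: eq_bigr => l _; rewrite mxE scalerA.
by move=> r; rewrite lfunE /= /table_fun /= [X in _ + X]big1 ?addr0 // => j _; rewrite mxE scale0r.
Qed.
End TableIso.
End Isomorphisms.

Lemma abelian_isomorphic (F : fieldType) (M : algebraType F) (k : nat) :
  \dim {:M} = k -> (forall x y : M, [br x, y] = 0) -> isomorphic M (abelian_alg F k).
Proof.
rewrite dimvf => <- M0.
exists (linfun v2r : 'Hom(M, abelian_alg F (dim M))); split.
  by exists r2v => v; rewrite lfunE /= ?v2rK ?r2vK.
move=> x y; rewrite M0 linear0; apply/esym.
by apply: big1 => i _; apply: big1 => j _; rewrite scaler0.
Qed.

Lemma table_br_delta (F : fieldType) n (T : nat -> nat -> 'rV[F]_n) (i j : 'I_n) :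
  [br (delta_mx 0 i : table_alg T), (delta_mx 0 j : table_alg T)] = T i j.
Proof.
rewrite [LHS](bigD1 i) //= [X in _ + X]big1 => [|l li]; last first.
  by apply: big1 => l' _; rewrite mxE (negPf li) andbF mul0r scale0r.
rewrite addr0 (bigD1 j) //= [X in _ + X]big1 => [|l li]; last first.
  by rewrite [X in _ * X]mxE (negPf li) andbF mulr0 scale0r.
by rewrite !mxE !eqxx mulr1 scale1r addr0.
Qed.

Lemma ord_inord n (i : 'I_n.+1) k : val i = k -> i = inord k.
Proof. by move=> <-; rewrite inord_val. Qed.

(** * Three-dimensional simple Lie algebras *)

(** The products of [d(m)] for the traceless [m] with rows [(p, q)] and [(r, -p)]; the last
    condition says that [det m], which is [-(p^2 + q r)], is non-zero. *)
Definition three_dim_basis (F : fieldType) (L : algebraType F) (p q r : F) (h x y : L) :=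
  [/\ [br h, x] = p *: x + q *: y /\ [br x, h] = - (p *: x + q *: y),
      [br h, y] = r *: x - p *: y /\ [br y, h] = - (r *: x - p *: y),
      [br x, y] = h /\ [br y, x] = - h,
      [/\ [br h, h] = 0, [br x, x] = 0 & [br y, y] = 0] &
      h != 0 /\ p ^+ 2 + q * r != 0].

(** Alternative (2) of [theorem1]. *)
Definition simple_case (F : fieldType) (L : leibnizType F) (n : nat) :=
  (is_lie L /\ almost_simple L) /\
  exists m : 'M[F]_2,
    [/\ \tr m = 0 /\ simple_lie (d_alg m),
        isomorphic L (d_alg m * abelian_alg F (n - 3))%type,
        isomorphic (subvs_of (center L)) (abelian_alg F (n - 3)) &
        unique_max_abelian_ideal (center L) /\ \dim (center L) = (n - 3)%N].

Section ThreeDim.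
Variables (F : fieldType) (L : algebraType F) (p q r : F) (h x y : L).
Hypothesis hxy : three_dim_basis p q r h x y.

(** Left multiplication by [h], applied twice, is the non-zero scalar [p^2 + q r] on the span of [x]
    and [y] and kills [h] and [z], so it isolates [b *: x + c *: y] in [J]; a product with [x] or
    [y] then yields [h]. This dichotomy gives the center, the maximality of [Z] and the simplicity
    of [d(m)]. *)
Lemma three_dim_ideal (J Z : {vspace L}) a b c z : ideal J ->
  (forall u, u \in Z -> forall v : L, [br u, v] = 0 /\ [br v, u] = 0) -> z \in Z ->
  a *: h + b *: x + c *: y + z \in J -> [/\ a = 0, b = 0 & c = 0] \/ [/\ h \in J, x \in J & y \in J].
Proof.
case: hxy => -[hx xh] [hy yh] [xy yx] [hh xx yy] [h0 k0] /idealP Jid Zc zZ jJ.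
have lJ v j : j \in J -> [br v, j] \in J by case/(Jid v).
have rJ v j : j \in J -> [br j, v] \in J by case/(Jid v).
have hJ : h \in J -> [/\ h \in J, x \in J & y \in J].
  move=> hJ; split=> //; rewrite -(memv_scaleE _ _ k0).
    by apply: (memv_eq (lJ h _ (rJ x _ hJ))); rewrite !(hx, hy, brE); vring.
  by apply: (memv_eq (lJ h _ (rJ y _ hJ))); rewrite !(hx, hy, brE); vring.
have vJ : b *: x + c *: y \in J.
  rewrite -(memv_scaleE _ _ k0); apply: (memv_eq (lJ h _ (lJ h _ jJ))).
  by rewrite !(hx, hy, hh, brE) (proj2 (Zc _ zZ h)) !(hx, hy, hh, brE); vring.
have [b0|b0] := eqVneq b 0; last first.
  right; apply: hJ; rewrite -(memv_scaleE _ _ b0); apply: (memv_eq (rJ y _ vJ)).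
  by rewrite !(yy, xy, brE); vring.
have [c0|c0] := eqVneq c 0; last first.
  right; apply: hJ; rewrite -(memv_scaleE _ _ c0); apply: (memv_eq (memv_opp (rJ x _ vJ))).
  by rewrite !(xx, yx, brE); vring.
have [a0|a0] := eqVneq a 0; [by left | right; apply: hJ].
(* Only [a *: h + z] is left; its product with [[br h, x]] is a non-zero multiple of [x]. *)
rewrite -xy; apply: (rJ); rewrite -(memv_scaleE _ _ k0) -(memv_scaleE _ _ a0).
apply: (memv_eq (rJ [br h, x] _ jJ)).
by rewrite b0 c0 brDl (proj1 (Zc _ zZ _)) !(hx, hy, brE); vring.
Qed.

End ThreeDim.

Section SimpleCase.
Variables (F : fieldType) (L : leibnizType F) (n : nat) (p q r : F) (h x y : L) (Z : {vspace L}).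
Hypothesis hxy : three_dim_basis p q r h x y.
Hypothesis dL : \dim {:L} = n.
Hypothesis dZ : (\dim Z + 3 = n)%N.
Hypothesis Zc : forall u, u \in Z -> forall v : L, [br u, v] = 0 /\ [br v, u] = 0.

Lemma ideal_Z : ideal Z.
Proof. by apply/idealP => v j /Zc jZ; case: (jZ v) => -> ->; rewrite mem0v. Qed.

(** The dichotomy applies to the ideal [Z] itself: if [x] were in [Z], then [h = [br x, y]] would
    vanish. *)
Lemma three_dim_free a b c z : z \in Z ->
  a *: h + b *: x + c *: y + z \in Z -> [/\ a = 0, b = 0 & c = 0].
Proof.
move=> zZ jZ; case: (three_dim_ideal hxy ideal_Z Zc zZ jZ) => // -[/Zc hZ /Zc xZ _].
by case: hxy => _ _ [xy _] _ [/eqP[]]; rewrite -xy; case: (xZ y).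
Qed.

Lemma three_dim_span v : exists a b c, exists2 z, z \in Z & v = a *: h + b *: x + c *: y + z.
Proof.
have hZ : h \notin Z.
  apply/negP => hZ; case: (@three_dim_free 1 0 0 0); rewrite ?mem0v //.
    by rewrite scale1r !scale0r !addr0.
  by move/eqP; rewrite oner_eq0.
have xZ : x \notin (Z + <[h]>)%VS.
  apply/memv_add_lineP => -[a xZ]; case: (@three_dim_free (- a) 1 0 0); rewrite ?mem0v //.
    by rewrite scale1r !scale0r !addr0 scaleNr addrC.
  by move=> _ /eqP; rewrite oner_eq0.
have yZ : y \notin (Z + <[h]> + <[x]>)%VS.
  apply/memv_add_lineP => -[b /memv_add_lineP[a yZ]].
  case: (@three_dim_free (- a) (- b) 1 0); rewrite ?mem0v //.
    by rewrite (_ : _ + _ = y - b *: x - a *: h) //; vring.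
  by move=> _ _ /eqP; rewrite oner_eq0.
have : v \in (Z + <[h]> + <[x]> + <[y]>)%VS.
  suff /eqP-> : (Z + <[h]> + <[x]> + <[y]>)%VS == fullv by rewrite memvf.
  by rewrite eqEdim subvf !dim_add_line //= dL -dZ addn3.
case/memv_add_lineP => c /memv_add_lineP[b /memv_add_lineP[a vZ]].
by exists a, b, c, (v - c *: y - b *: x - a *: h) => //; vring.
Qed.

Lemma three_dim_lie : is_lie L.
Proof.
split=> [|v]; first exact: br_leibniz.
have [a [b [c [z zZ ->]]]] := three_dim_span v.
case: hxy => -[hx xh] [hy yh] [xy yx] [hh xx yy] _.
rewrite !brE !(proj1 (Zc zZ _)) !(proj2 (Zc zZ _)) hx xh hy yh xy yx hh xx yy; vring.
Qed.

Lemma center_three_dim : center L = Z.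
Proof.
have idC : ideal (center L).
  by apply/idealP => v j /centerP /(_ v)[-> ->]; rewrite mem0v.
apply/vspaceP => v; apply/idP/idP => [vC | /Zc vZ]; last by apply/centerP.
have [a [b [c [z zZ vE]]]] := three_dim_span v; rewrite vE in vC *.
case: (three_dim_ideal hxy idC Zc zZ vC) => [[-> -> ->] | [_ /centerP xC _]].
  by rewrite !scale0r !add0r.
by case: hxy => _ _ [xy _] _ [/eqP[]]; rewrite -xy; case: (xC y).
Qed.

Lemma three_dim_max : unique_max_abelian_ideal Z.
Proof.
split.
  rewrite /abelian_ideal ideal_Z; apply/abelianP => u v /Zc uZ _.
  by case: (uZ v).
move=> J /andP[idJ /abelianP abJ]; have JZ : (J <= Z)%VS.
  apply/subvP => v vJ; have [a [b [c [z zZ vE]]]] := three_dim_span v; rewrite vE in vJ *.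
  case: (three_dim_ideal hxy idJ Zc zZ vJ) => [[-> -> ->] | [_ xJ yJ]].
    by rewrite !scale0r !add0r.
  by case: hxy => _ _ [xy _] _ [/eqP[]]; rewrite -xy abJ.
split=> [|dJ]; first exact: dimvS.
by apply/eqP; rewrite eqEdim JZ dJ leqnn.
Qed.

Let m : 'M[F]_2 := \matrix_(i, j)
  if i == ord0 then (if j == ord0 then p else q) else (if j == ord0 then r else - p).

(** The Lie identities are pulled back from [L] along the first summand; simplicity is the ideal
    dichotomy inside [d(m)], with zero in the role of [Z]. *)
Lemma simple_d_alg (f : 'Hom((d_alg m * abelian_alg F (n - 3))%type, L)) :
  is_alg_iso f -> simple_lie (d_alg m).
Proof.
case=> -[g fK _] fM; have [_ Lsq] := three_dim_lie.
pose i3 k : 'I_3 := inord k.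
pose e k : d_alg m := delta_mx 0 (i3 k).
have brd (i j : nat) : (i < 3)%N -> (j < 3)%N -> [br e i, e j] = d_table m i j.
  by move=> i3' j3; rewrite table_br_delta !inordK.
have dB : three_dim_basis p q r (e 0) (e 1) (e 2).
  split; rewrite ?brd //= ?[m _ _]mxE /= ?scaleNr //.
  split; last by case: hxy => _ _ _ _ [].
  by apply/eqP => /matrixP/(_ 0 0)/eqP; rewrite !mxE eqxx -val_eqE /= inordK // oner_eq0.
have jD (u v : d_alg m) : f (u + v, 0) = f (u, 0) + f (v, 0).
  by rewrite -linearD; congr (f (_, _)); rewrite addr0.
have j1 (u v : d_alg m) : f ([br u, v], 0) = [br f (u, 0), f (v, 0)].
  by rewrite -fM; congr (f (_, _)); rewrite /= br0l.
have inj (u v : d_alg m) : f (u, 0) = f (v, 0) -> u = v.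
  by move=> /(can_inj fK) [].
split.
- split=> [u v w | u]; apply: inj.
  + by rewrite jD !j1 leib.
  + by rewrite j1 Lsq linear0.
- apply/negP => /abelianP ab; case: dB => _ _ [xy _] _ [/eqP[]].
  by rewrite -xy ab ?memvf.
- move=> I idI.
  have uE (u : d_alg m) : u = (u : 'rV_3) 0 (i3 0) *: e 0 + (u : 'rV_3) 0 (i3 1) *: e 1
       + (u : 'rV_3) 0 (i3 2) *: e 2 + 0.
    rewrite [LHS](row_sum_delta (u : 'rV_3)) !big_ord_recl big_ord0 addr0 addrA.
    rewrite (@ord_inord _ (lift _ (lift _ _)) 2) // (@ord_inord _ (lift _ _) 1) //.
    by rewrite (@ord_inord _ ord0 0) // addr0.
  have [-> | ] := eqVneq I 0%VS; [by left | right].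
  apply/eqP; rewrite eqEsubv subvf; apply/subvP => u _.
  have [w wI w0] : exists2 w, w \in I & w != 0.
    by exists (vpick I); rewrite ?memv_pick ?vpick0.
  have z0 (z : d_alg m) : z \in 0%VS -> forall v : d_alg m, [br z, v] = 0 /\ [br v, z] = 0.
    by rewrite memv0 => /eqP -> v; rewrite br0l br0r.
  rewrite (uE w) in wI w0.
  case: (three_dim_ideal dB idI z0 (mem0v _) wI) => [[a0 b0 c0] | [e0 e1 e2]].
    by rewrite a0 b0 c0 !scale0r !addr0 eqxx in w0.
  by rewrite (uE u); memv_auto.
Qed.

Lemma simple_caseI : simple_case L n.
Proof.
have [f [fiso _]] : exists f : 'Hom((d_alg m * abelian_alg F (n - 3))%type, L),
  is_alg_iso f /\ forall s, f (s, 0) = \sum_i (s : 'rV[F]_3) 0 i *: nth 0 [:: h; x; y] i.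
  apply: (@table_iso _ _ _ _ _ _ Z) => //.
  - by rewrite -dZ addnK.
  - by rewrite dL -dZ addnK addnC.
  - move=> s; rewrite !big_ord_recl big_ord0 /= addr0 => sZ.
    have /(three_dim_free (mem0v Z))[s0 s1 s2] : s 0 ord0 *: h + s 0 (lift ord0 ord0) *: x +
        s 0 (lift ord0 (lift ord0 ord0)) *: y + 0 \in Z by rewrite addr0 -addrA.
    by rewrite [LHS]row_sum_delta !big_ord_recl big_ord0 s0 s1 s2 !scale0r !addr0.
  - case: hxy => -[hx xh] [hy yh] [xy yx] [hh xx yy] _.
    case=> [[|[|[|//]]] ?]; case=> [[|[|[|//]]] ?] /=; rewrite !big_ord_recl big_ord0 ?mxE -?val_eqE /= ?inordK //=;
      rewrite ?hx ?xh ?hy ?yh ?xy ?yx ?hh ?xx ?yy; vring.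

have iso : isomorphic L (d_alg m * abelian_alg F (n - 3))%type.
  by apply: isomorphic_sym; exists f.
have simp := simple_d_alg fiso.
split; first by split; [exact: three_dim_lie | exists (d_alg m), (n - 3)%N].
exists m; split=> //.
- split=> //; rewrite /mxtrace !big_ord_recl big_ord0 !mxE /= addr0 subrr //.
- rewrite center_three_dim; apply: abelian_isomorphic.
    by rewrite dimvf /dim /= -dZ addnK.
  move=> u v; apply: subvs_inj; rewrite sub_brE ?linear0.
    by case: (Zc (subvsP u) (vsval v)).
  by apply/brv_sub => a b /Zc aZ _; case: (aZ b) => ->; rewrite mem0v.
- by rewrite center_three_dim -dZ addnK; split=> //; apply: three_dim_max.
Qed.
End SimpleCase.

(** * One-dimensional extensions of the Heisenberg algebra *)

Lemma induces_quotv (F : fieldType) (V : vectType F) (U : {vspace V}) (f : 'End(V)) :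
  (forall x, x \in U -> f x \in U) -> exists fq : 'End(quotv U), induces f fq.
Proof.
move=> fU; exists (quotv_pi U \o f \o linfun vsval)%VF => x.
rewrite (comp_lfunE (quotv_pi U \o f)%VF) (comp_lfunE (quotv_pi U) f) (lfunE vsval) /= quotv_piE linearB linearB /= -[RHS]subr0; congr (_ - _).
by apply/eqP; rewrite -memv_ker lker_quotv_pi fU ?memv_proj.
Qed.

Lemma vsval_preim (F : fieldType) (V : vectType F) (B U : {vspace V}) : (U <= B)%VS ->
  let U' := (linfun (vsval : subvs_of B -> V) @^-1: U)%VS in
  [/\ forall w, (w \in U') = (vsval w \in U), (linfun vsval @: U')%VS = U & \dim U' = \dim U].
Proof.
move=> UB U'.
have imB : limg (linfun (vsval : subvs_of B -> V)) = B.
  apply/vspaceP => v; apply/memv_imgP/idP => [[w _ ->] | vB]; first by rewrite lfunE subvsP.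
  by exists (vsproj B v); rewrite ?memvf // lfunE /= vsprojK.
have U'E : (linfun vsval @: U')%VS = U by rewrite lpreimK // imB.
split=> //; first by move=> w; rewrite -memv_preim lfunE.
rewrite -[in RHS]U'E limg_dim_eq //; apply/eqP; rewrite -subv0; apply/subvP => w.
by rewrite memv_cap memv_ker lfunE memv0 -(inj_eq subvs_inj) linear0 => /andP[].
Qed.

(** Alternative (3) of [theorem1]. *)
Definition heisenberg_case (F : fieldType) (L : leibnizType F) (n : nat) :=
  step_solvable L 3 /\
  exists B : {vspace L},
    [/\ is_nilradical B,
        isomorphic (subvs_of B) (heisenberg F * abelian_alg F (n - 4))%type,
        (exists (phi theta : 'End(subvs_of B)) (v : subvs_of B)
                (g : 'Hom(ext_alg phi theta v, L)),
           [/\ v \in center (subvs_of B) /\ in_leibniz_kernel (vsval v),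
               left_derivation phi,
               is_alg_iso g /\ (forall b : subvs_of B, g (0, b) = vsval b) &
               exists phiq thetaq : 'End(quotv (center (subvs_of B))),
                 [/\ induces phi phiq, induces theta thetaq,
                     phiq = - thetaq & irreducible_map phiq]]) &
        (let CB := (linfun vsval @: center (subvs_of B))%VS in
         unique_max_abelian_ideal CB /\ \dim CB = (n - 3)%N)].

Section HeisenbergCase.
Variables (F : fieldType) (L : leibnizType F) (n : nat) (B Z : {vspace L}) (y : L).
Hypotheses (dL : \dim {:L} = n) (dB : (\dim B + 1 = n)%N) (dZ : (\dim Z + 3 = n)%N).
Hypotheses (ZB : (Z <= B)%VS) (yB : y \notin B).
Hypothesis ZK : forall z b, z \in Z -> b \in B -> [br z, b] = 0 /\ [br b, z] = 0.
Hypothesis BZ : forall b c, b \in B -> c \in B -> [br b, c] \in Z.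
Hypothesis sqB : forall b, b \in B -> [br b, b] = 0.
Hypothesis adyB : forall b, b \in B -> [br y, b] \in B.
Hypothesis adyZ : forall z, z \in Z -> [br y, z] \in Z.
Hypothesis symyB : forall b, b \in B -> [br y, b] + [br b, y] \in Z.
Hypothesis yyZ : [br y, y] \in Z.

Let sZB z : z \in Z -> z \in B. Proof. exact: (subvP ZB). Qed.

Let spanL v : exists a, exists2 b, b \in B & v = a *: y + b.
Proof. by apply: (span1 (subvf B) (memvf y) yB _ (memvf v)); rewrite dL -dB addn1. Qed.

Let adyrB b : b \in B -> [br b, y] \in B.
Proof.
move=> bB; rewrite -[[br b, y]](addKr [br y, b]) addrC.
by apply: memvB; [apply: sZB; apply: symyB | apply: adyB].
Qed.

Let adyrZ z : z \in Z -> [br z, y] \in Z.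
Proof.
move=> zZ; rewrite -[[br z, y]](addKr [br y, z]) addrC.
by apply: memvB; [apply/symyB/sZB | apply: adyZ].
Qed.

Let idB : ideal B.
Proof.
apply/idealP => v j jB; have [a [b bB ->]] := spanL v.
by rewrite !brE; split; memv_auto; auto.
Qed.

Let idZ : ideal Z.
Proof.
apply/idealP => v j jZ; have [a [b bB ->]] := spanL v.
have [e1 e2] := ZK jZ bB.
by rewrite !brE e1 e2 !addr0; split; memv_auto; auto.
Qed.

(** As [Z] has codimension two in [B], such a [J] is [Z] plus one line, hence abelian: squares in
    [B] vanish and [Z] annihilates [B]. Right multiplication by [y] preserves it, being the negative
    of the left one modulo [Z]. *)
Lemma invariant_small_abelian (J : {vspace L}) : (Z <= J)%VS -> (J <= B)%VS ->
  J <> Z -> J <> B -> (forall j, j \in J -> [br y, j] \in J) -> small_abelian_ideal L n.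
Proof.
move=> ZJ JB JZ JnB yJ; have sZJ z : z \in Z -> z \in J by apply: (subvP ZJ).
have sJB z : z \in J -> z \in B by apply: (subvP JB).
have [j jJ jZ] : exists2 j, j \in J & j \notin Z.
  by apply/subvPn/negP => JZ'; apply: JZ; apply/eqP; rewrite eqEsubv JZ'.
have JE : J = (Z + <[j]>)%VS.
  apply/esym/eqP; rewrite eqEdim subv_add ZJ -memvE jJ dim_add_line //=.
  have := dimvS JB; rewrite leq_eqVlt => /orP[dJB | dJB].
    by case: JnB; apply/eqP; rewrite eqEdim JB (eqP dJB) /=.
  by rewrite -ltnS (leq_trans dJB) // -(leq_add2r 1) dB -dZ addn3 addn1.
apply: (small_abelian_idealI dL (J := J)).
- apply/idealP => v k kJ; have [a [b bB ->]] := spanL v.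
  have kB := sJB k kJ; have ky : [br k, y] \in J.
    rewrite -[[br k, y]](addKr [br y, k]) addrC.
    by apply: memvB; [apply/sZJ/symyB/sJB | apply: yJ].
  by rewrite !brE; split; memv_auto; auto.
- apply/abelianP => u v; rewrite JE => /memv_add_lineP[a uZ] /memv_add_lineP[b vZ].
  rewrite -(subrK (a *: j) u) -(subrK (b *: j) v).
  move: (u - _) (v - _) uZ vZ => {}u {}v uZ vZ.
  have jB := sJB j jJ.
  rewrite !brE (sqB jB) (proj1 (ZK uZ jB)) (proj2 (ZK vZ jB)) (proj1 (ZK uZ (sZB vZ))).
  by rewrite !scaler0 !addr0.
- by rewrite JE dim_add_line // -dZ addSnnS.
Qed.

(** * Irreducible action of [y] on [B / Z] *)

Section Irreducible.
Variables (e f : L).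
Hypotheses (eB : e \in B) (fB : f \in B) (ef0 : [br e, f] != 0).
Hypothesis irr : forall J : {vspace L}, (Z <= J)%VS -> (J <= B)%VS ->
  (forall j, j \in J -> [br y, j] \in J) -> J = Z \/ J = B.

Let u := [br e, f].

Let skew b c : b \in B -> c \in B -> [br b, c] = - [br c, b].
Proof.
move=> bB cB; apply/eqP; rewrite -addr_eq0; apply/eqP.
have := sqB (memvD bB cB).
by rewrite !brE (sqB bB) (sqB cB) add0r addr0 addrC.
Qed.

Let uZ : u \in Z. Proof. exact: BZ. Qed.

Let free_ef : free2 Z e f.
Proof.
move=> a b abZ; split; apply/eqP.
  have := proj1 (ZK abZ fB); rewrite !brE (sqB fB) scaler0 addr0 => /eqP.
  by rewrite scaler_eq0 (negPf ef0) orbF.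
have := proj2 (ZK abZ eB); rewrite !brE (sqB eB) scaler0 add0r => /eqP.
by rewrite scaler_eq0 (negPf ef0) orbF.
Qed.

Let spanB b : b \in B -> exists a c, exists2 z, z \in Z & b = a *: e + c *: f + z.
Proof. by apply: (span2 ZB eB fB free_ef); rewrite -(leq_add2r 1) dB -dZ addn3 addn1. Qed.

Let eZ : e \notin Z.
Proof.
apply/negP => eZ; case: (@free_ef 1 0); first by rewrite scale1r scale0r addr0.
by move/eqP; rewrite oner_eq0.
Qed.

Let ZnB : Z <> B.
Proof. by move=> ZB'; case/negP: eZ; rewrite ZB'. Qed.

(** The elements of [B] that [y] sends into [Z] form an invariant subspace. Were it all of [B],
    every line of [B / Z] would be invariant, in particular that of [e]. *)
Lemma ady_inj b : b \in B -> [br y, b] \in Z -> b \in Z.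
Proof.
move=> bB ybZ; pose J := (B :&: (ad_l y @^-1: Z))%VS.
have JP c : (c \in J) = (c \in B) && ([br y, c] \in Z) by rewrite memv_cap -memv_preim ad_lE.
case: (@irr J).
- by apply/subvP => z zZ; rewrite JP sZB // adyZ.
- exact: capvSl.
- move=> j; rewrite !JP => /andP[jB yjZ]; rewrite adyB // adyZ //.
- by move=> JZ; rewrite -JZ JP bB.
move=> JB; have yBZ c : c \in B -> [br y, c] \in Z by rewrite -{1}JB JP => /andP[].
pose K := (Z + <[e]>)%VS; have ZK' : (Z <= K)%VS by apply: addvSl.
have eK : e \in K by apply: subvP (memv_line e); apply: addvSr.
have KB : (K <= B)%VS by rewrite subv_add ZB -memvE.
case: (@irr K) => //.
- by move=> j /(subvP KB) jB; apply: (subvP ZK'); apply: yBZ.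
- by move=> KZ; case/negP: eZ; rewrite -KZ.
- move=> KB'; have := fB; rewrite -KB' => /memv_add_lineP[a faZ].
  case: (@free_ef (- a) 1); first by rewrite scale1r addrC scaleNr.
  by move=> _ /eqP; rewrite oner_eq0.
Qed.

Lemma ady_full (K : {vspace L}) : (Z <= K)%VS -> (K <= B)%VS ->
  (forall b, b \in B -> [br y, b] \in K) -> K = B.
Proof.
move=> ZK' KB yK; case: (irr ZK' KB) => [j /(subvP KB)/yK // | KZ | //].
case/negP: eZ; apply: ady_inj => //; rewrite -KZ; exact: yK.
Qed.

(** The hypothesis says that [J] covers [B / Z]. Representatives in [J] of the classes of [e] and
    [f] still have product [u], because [Z] annihilates [B]. *)
Lemma full_commutator (J : {vspace L}) : (J :&: B + Z)%VS = B ->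
  exists j k, [/\ j \in J, k \in J & [br j, k] = u].
Proof.
move=> JB; have: e \in (J :&: B + Z)%VS by rewrite JB.
have: f \in (J :&: B + Z)%VS by rewrite JB.
case/memv_addP => k /memv_capP[kJ kB] [w wZ fE]; case/memv_addP => j /memv_capP[jJ jB] [z zZ eE].
exists j, k; split=> //; rewrite /u eE fE.
have [_ jw] := ZK wZ jB; have [zk _] := ZK zZ kB; have [zw _] := ZK zZ (sZB wZ).
by rewrite !brE jw zk zw !addr0.
Qed.

(** On [B / Z] the element [y + b] acts as [y], hence surjectively. So covering [B / Z] passes to
    ideals outside [B] and from one term of a series to the next. *)
Lemma cap_full (J K : {vspace L}) b : b \in B -> (J :&: B + Z)%VS = B ->
  (forall j, j \in J -> [br y + b, j] \in K) -> (K :&: B + Z)%VS = B.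
Proof.
move=> bB JB yK; apply: ady_full; rewrite ?addvSr ?subv_add ?capvSr // => c.
rewrite -{1}JB => /memv_addP[j /memv_capP[jJ jB] [z zZ ->]].
apply/memv_addP; exists [br y + b, j].
  rewrite memv_cap yK // brDl; apply: memvD; [exact: adyB | exact/sZB/BZ].
by exists ([br y, z] - [br b, j]); [apply: memvB; [exact: adyZ | exact: BZ] | rewrite !brE; vring].
Qed.

Let BB_full : (fullv :&: B + Z)%VS = B.
Proof. by rewrite capfv; apply/addv_idPl. Qed.

Lemma ideal_full (J : {vspace L}) : ideal J -> ~~ (J <= B)%VS ->
  exists2 b, b \in B & y + b \in J /\ (J :&: B + Z)%VS = B.
Proof.
move=> idJ /subvPn[v vJ vB]; have [a [b bB vE]] := spanL v.
have a0 : a != 0 by apply: contraNneq vB => a0; rewrite vE a0 scale0r add0r.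
have ybJ : y + a^-1 *: b \in J.
  by rewrite -(memv_scaleE _ _ a0) scalerDr scalerA divff // scale1r -vE.
exists (a^-1 *: b); [exact: memvZ | split=> //].
apply: (cap_full (memvZ a^-1 bB) BB_full) => j _.
by case: (idealP _ idJ j _ ybJ).
Qed.

(** An abelian [J] cannot cover [B / Z], since [[br e, f]] is non-zero; this forces [J] into [B],
    and irreducibility then leaves only [(J + Z)%VS = Z]. *)
Lemma abelian_ideal_sub (J : {vspace L}) : abelian_ideal J -> (J <= Z)%VS.
Proof.
case/andP => idJ /abelianP abJ.
have nJ : (J :&: B + Z)%VS <> B.
  by case/full_commutator => j [k [jJ kJ jk]]; case/eqP: ef0; rewrite -/u -jk abJ.
have JB : (J <= B)%VS by apply: contraT => /(ideal_full idJ)[b _ [_ /nJ]].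
case: (@irr (J + Z)%VS).
- exact: addvSr.
- by rewrite subv_add JB.
- move=> _ /memv_addP[j jJ [z zZ ->]]; rewrite brDr memv_add ?adyZ //.
  by case: (idealP _ idJ y _ jJ).
- by move=> <-; apply: addvSl.
- by rewrite -{1}(capv_idPl JB).
Qed.

Lemma max_abelian_Z : unique_max_abelian_ideal Z.
Proof.
split.
  by rewrite /abelian_ideal idZ; apply/abelianP => a b aZ /sZB bB; case: (ZK aZ bB).
move=> J /abelian_ideal_sub JZ; split=> [|dJ]; first exact: dimvS.
by apply/eqP; rewrite eqEdim JZ dJ leqnn.
Qed.

Let BBZ : (brv B B <= Z)%VS. Proof. by apply/brv_sub => b c bB cB; apply: BZ. Qed.
Let ZB0 : brv Z B = 0%VS.
Proof. by apply/eqP; rewrite -subv0; apply/brv_sub => z b zZ bB; rewrite (proj1 (ZK zZ bB)) mem0v. Qed.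
Let BZ0 : brv B Z = 0%VS.
Proof. by apply/eqP; rewrite -subv0; apply/brv_sub => b z bB zZ; rewrite (proj2 (ZK zZ bB)) mem0v. Qed.

(** [B] is nilpotent because [[B, B]] lies in [Z]. An ideal not inside [B] contains some [y + b], so
    every term of its lower central series covers [B / Z] and none is zero. *)
Lemma nilradical_B : is_nilradical B.
Proof.
split=> //.
  by exists 2; apply/eqP; rewrite -subv0 -BZ0; apply: brv_mono.
move=> J idJ [k lk]; apply: contraT => /(ideal_full idJ)[b bB [ybJ JB]].
have lB i : (lcs J i :&: B + Z)%VS = B.
  elim: i => [//|i IH]; apply: (cap_full bB IH) => j jl.
  exact: memv_br.
by have := lB k; rewrite lk cap0v add0v => /ZnB.
Qed.

Lemma step_solvable_B : step_solvable L 3.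
Proof.
have d1 : (derived L 1 <= B)%VS.
  apply/brv_sub => v w _ _; have [a [b bB ->]] := spanL v; have [c [d dB' ->]] := spanL w.
  by rewrite !brE; memv_auto; auto.
have d2 : (derived L 2 <= Z)%VS by apply: subv_trans BBZ; apply: brv_mono.
split.
  by apply/eqP; rewrite -subv0 -ZB0; apply: brv_mono => //; apply: subv_trans d2 ZB.
(* [L^2] covers [B / Z], so [u] is a product of two of its elements and [L^(2)] is non-zero. *)
have : (derived L 1 :&: B + Z)%VS = B.
  by apply: (cap_full (mem0v B) BB_full) => j _; rewrite memv_br ?memvf.
case/full_commutator => j [k [jJ kJ jk]] d20; case/eqP: ef0.
by apply/eqP; rewrite -memv0 -[0%VS]d20 -/u -jk memv_br.
Qed.

Let sB : subalgebra B.
Proof. by apply: subv_trans BBZ ZB. Qed.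

Lemma center_B : center (subvs_of B) = (linfun vsval @^-1: Z)%VS.
Proof.
have [ZE _ _] := vsval_preim ZB.
apply/vspaceP => w; rewrite ZE; apply/centerP/idP => [wC | wZ v].
  have [a [c [z zZ wE]]] := spanB (subvsP w).
  have kill b : b \in B -> [br vsval w, b] = 0 /\ [br b, vsval w] = 0.
    move=> bB; have [] := wC (vsproj B b).
    by move=> /(congr1 vsval) + /(congr1 vsval); rewrite !sub_brE // !linear0 !vsprojK.
  have := proj1 (kill f fB); have := proj2 (kill e eB).
  rewrite wE !brE (sqB eB) (sqB fB) (proj1 (ZK zZ fB)) (proj2 (ZK zZ eB)).
  rewrite !scaler0 !addr0 add0r => /eqP; rewrite scaler_eq0 (negPf ef0) orbF => /eqP->.
  by move=> /eqP; rewrite scaler_eq0 (negPf ef0) orbF => /eqP->; rewrite !scale0r !add0r.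
have [e1 e2] := ZK wZ (subvsP v).
by split; apply: subvs_inj; rewrite sub_brE ?linear0.
Qed.

Lemma isomorphic_B : isomorphic (subvs_of B) (heisenberg F * abelian_alg F (n - 4))%type.
Proof.
(* [e, f, u] span the Heisenberg algebra; a complement of the line of [u] in [Z] is the abelian
   summand. *)
pose W := (Z :\: <[u]>)%VS; have WZ : (W <= Z)%VS by apply: diffvSl.
have [WE _ dW] := vsval_preim (subv_trans WZ ZB).
have dWn : (\dim W + 4 = n)%N.
  have := dimv_cap_compl Z <[u]>; rewrite (capv_idPr _) -?memvE // dim_vline ef0 => dWZ.
  by move: dWZ dZ; rewrite -/W /= => <- <-; rewrite add1n addSnnS.
have XE (s : 'rV[F]_3) : \sum_i s 0 i *: vsproj B (nth 0 [:: e; f; u] i) =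
    vsproj B (s 0 ord0 *: e + s 0 (lift ord0 ord0) *: f + s 0 (lift ord0 (lift ord0 ord0)) *: u).
  by rewrite !big_ord_recl big_ord0 /= !linearD !linearZ /= addr0 addrA.
apply: isomorphic_sym; have [|||||g [gi _]] := @table_iso F (subvs_of B) 3 (n - 4) (heis_table F)
  (fun i => vsproj B (nth 0 [:: e; f; u] i)) (linfun vsval @^-1: W)%VS; last by exists g.
- by rewrite dW -dWn addnK.
- by apply/eqP; rewrite dimvf -[X in X == _]/(\dim B) -(eqn_add2r 1) dB -dWn addnK (addnAC 3) addnC.
- move=> s; rewrite XE WE vsprojK; last by memv_auto; auto.
  set s0 := s 0 _; set s1 := s 0 _; set s2 := s 0 _ => sW.
  have [s00 s10] : s0 = 0 /\ s1 = 0.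
    apply: free_ef; rewrite -(addrK (s2 *: u) (_ + _)); apply: memvB; last exact: memvZ.
    exact: (subvP WZ).
  move: sW; rewrite s00 s10 !scale0r !add0r => sW.
  have : s2 *: u \in (W :&: <[u]>)%VS by rewrite memv_cap sW memvZ ?memv_line.
  rewrite capv_diff memv0 scaler_eq0 (negPf ef0) orbF => /eqP s20.
  by rewrite [LHS]row_sum_delta !big_ord_recl big_ord0 -/s0 -/s1 -/s2 s00 s10 s20 !scale0r !addr0.
- move=> z; rewrite WE => /(subvP WZ) zZ v; have [e1 e2] := ZK zZ (subvsP v).
  by split; apply: subvs_inj; rewrite sub_brE ?linear0.
- move=> i j; rewrite XE; apply: subvs_inj; rewrite sub_brE //; move: i j.
  have [[uBl uBr] [uBl' uBr']] := (ZK uZ eB, ZK uZ fB); have [uu _] := ZK uZ (sZB uZ).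
  have uB := sZB uZ; have ee := sqB eB; have ff := sqB fB; have fe := skew fB eB.
  case=> [[|[|[|//]]] ?]; case=> [[|[|[|//]]] ?] /=; rewrite !vsprojK; try (by memv_auto);
    rewrite ?mxE -?val_eqE /= ?inordK //= -/u ?uBl ?uBr ?uBl' ?uBr' ?uu ?ee ?ff ?fe; vring.
Qed.

Definition ext_fun (phi theta : 'End(subvs_of B)) v (s : ext_alg phi theta v) : L :=
  (s.1 : F) *: y + vsval s.2.

Lemma ext_fun_linear phi theta v : linear (@ext_fun phi theta v).
Proof.
move=> a [l1 b1] [l2 b2]; rewrite /ext_fun /= scalerDr scalerA addrACA -scalerDl.
congr (_ + _); exact: linearP.
Qed.

HB.instance Definition _ phi theta v :=
  GRing.isLinear.Build _ _ _ _ (@ext_fun phi theta v) (@ext_fun_linear phi theta v).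

Lemma heisenberg_caseI : heisenberg_case L n.
Proof.
have [ZE vZ dZ'] := vsval_preim ZB; rewrite -center_B in ZE vZ dZ'.
split; first exact: step_solvable_B.
exists B; split; [exact: nilradical_B | exact: isomorphic_B | | ]; last first.
  by rewrite /= vZ; split; [exact: max_abelian_Z | rewrite -dZ addnK].
(* The extension data are left multiplication by [y], right multiplication by [y] and the square of
   [y]. Being a square, [v] lies in [I_L], and [symyB] makes the induced maps opposite. *)
pose phi : 'End(subvs_of B) := (linfun (vsproj B) \o ad_l y \o linfun vsval)%VF.
pose theta : 'End(subvs_of B) := (linfun (vsproj B) \o ad_r y \o linfun vsval)%VF.
have phiE b : vsval (phi b) = [br y, vsval b].
  by rewrite !comp_lfunE !lfunE /= vsprojK // adyB ?subvsP.
have thetaE b : vsval (theta b) = [br vsval b, y].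
  by rewrite !comp_lfunE !lfunE /= vsprojK // adyrB ?subvsP.
pose v := vsproj B [br y, y].
have vE : vsval v = [br y, y] by rewrite vsprojK ?sZB.
exists phi, theta, v, (linfun (@ext_fun phi theta v)); split.
- split; first by rewrite ZE vE.
  by exists [:: y]; rewrite vE memv_span ?mem_head.
- move=> a b; apply: subvs_inj; rewrite phiE linearD /= !sub_brE // !phiE; exact: leib.
- split; [split|].
  + apply: inj_lfun_bij; last by rewrite dL -dB dimvf -[LHS]/(1 + \dim B)%N addnC.
    case=> l b; rewrite lfunE /= /ext_fun /= => lb0.
    have l0 : (l : F) = 0.
      apply: (@scaleK0 F L B l y _ yB); have -> : (l : F) *: y = - vsval b.
        by apply/eqP; rewrite -addr_eq0 lb0.
      exact/memv_opp/subvsP.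
    congr pair => //; apply: subvs_inj; move: lb0.
    by rewrite l0 scale0r add0r linear0.
  + move=> [l a] [m b]; rewrite !lfunE /= /ext_fun /= scale0r add0r.
    rewrite !linearD !linearZ /= phiE thetaE vE sub_brE // !brE; vring.
  + by move=> b; rewrite lfunE /= /ext_fun /= scale0r add0r.
have [x xZ | phiq phiqP] := @induces_quotv _ _ (center (subvs_of B)) phi.
  by rewrite ZE in xZ; rewrite ZE phiE adyZ.
set C := center (subvs_of B) in ZE *.
have piE (b : subvs_of B) : (quotv_pi C b == 0) = (vsval b \in Z) by rewrite -memv_ker lker_quotv_pi ZE.
have pi_surj w : exists b, w = quotv_pi C b.
  by have := memvf w; rewrite -limg_quotv_pi => /memv_imgP[b _ ->]; exists b.
exists phiq, (- phiq); split; rewrite ?opprK //.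
- move=> b; apply/eqP; rewrite opp_lfunE phiqP eq_sym -subr_eq0 opprK -linearD piE.
  by rewrite linearD /= phiE thetaE addrC symyB ?subvsP.
- move=> W phiqW.
  pose J := (linfun vsval @: (quotv_pi C @^-1: W))%VS.
  have JP (b : subvs_of B) : (vsval b \in J) = (quotv_pi C b \in W).
    rewrite memv_preim; apply/memv_imgP/idP => [[c cW] | bW]; last by exists b; rewrite ?lfunE.
    by rewrite lfunE /= => /subvs_inj->.
  have JB : (J <= B)%VS by apply/subvP => _ /memv_imgP[b _ ->]; rewrite lfunE; apply: subvsP.
  have [|j jJ|JZ|JB'] := irr _ JB.
  + apply/subvP => z zZ; have zE := vsprojK (sZB zZ); rewrite -zE JP.
    by have /eqP-> : quotv_pi C (vsproj B z) == 0; rewrite ?mem0v // piE zE.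
  + have jE := vsprojK (subvP JB _ jJ).
    move: jJ; rewrite -jE -phiE !JP -phiqP => jW.
    exact: (subvP phiqW) (memv_img _ jW).
  + left; apply/eqP; rewrite -subv0; apply/subvP => w; have [b ->] := pi_surj w.
    by rewrite -JP JZ -piE memv0.
  + right; apply/eqP; rewrite eqEsubv subvf; apply/subvP => w _.
    by have [b ->] := pi_surj w; rewrite -JP JB' subvsP.
Qed.

End Irreducible.

(** Without an invariant subspace strictly between [Z] and [B], either [B] is an abelian ideal of
    codimension one or two of its elements have a non-zero product. *)
Lemma heisenberg_or_small : small_abelian_ideal L n \/ heisenberg_case L n.
Proof.
have [[J [ZJ JB JZ JnB yJ]] | irr] := classic (exists J : {vspace L},
    [/\ (Z <= J)%VS, (J <= B)%VS, J <> Z, J <> B & forall j, j \in J -> [br y, j] \in J]).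
  by left; apply: invariant_small_abelian yJ.
have [abB | nabB] := boolP (abelian B).
  by left; apply: (small_abelian_idealI dL idB abB); rewrite -dB leq_add2l.
have [[e [f [eB fB ef]]] | nef] :=
    classic (exists e f, [/\ e \in B, f \in B & [br e, f] != 0]).
  right; apply: (heisenberg_caseI eB fB ef) => J ZJ JB yJ.
  have [-> | /eqP JZ] := eqVneq J Z; first by left.
  have [-> | /eqP JnB] := eqVneq J B; first by right.
  by case: irr; exists J.
case/negP: nabB; apply/abelianP => e f eB fB; apply/eqP.
by apply: contraT => ef; case: nef; exists e, f.
Qed.
End HeisenbergCase.

(** * The action on L / A by singular maps *)

Section CodimensionTwo.
Variables (F : fieldType) (L : leibnizType F) (n : nat) (A : {vspace L}).
Hypotheses (two0 : (2%:R : F) != 0) (dL : \dim {:L} = n) (dA : (\dim A + 2 = n)%N).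
Hypothesis abA : {in A &, forall a b, [br a, b] = 0}.
Implicit Types (a b c : L) (U : {vspace L}).

Lemma spanA x y : free2 A x y ->
  forall v, exists s t, exists2 c, c \in A & v = s *: x + t *: y + c.
Proof.
by move=> fr v; apply: (span2 (subvf A) (memvf x) (memvf y) fr) (memvf v); rewrite dL -dA addn2.
Qed.

Lemma br_ll a b v : a \in A -> b \in A -> [br a, [br b, v]] = [br b, [br a, v]].
Proof. by move=> aA bA; rewrite leib (abA aA bA) br0l add0r. Qed.
Lemma br_lr a b v : a \in A -> b \in A -> [br a, [br v, b]] = [br [br a, v], b].
Proof. by move=> aA bA; rewrite leib (abA aA bA) br0r addr0. Qed.
Lemma br_rr a b v : a \in A -> b \in A -> [br [br v, a], b] = - [br a, [br v, b]].
Proof. by move=> aA bA; rewrite leib_l (abA aA bA) br0r sub0r. Qed.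

(** The criterion for ideals made of one vector [z] and a subspace [U] of codimension at most one in
    [A]. Closure is tested on [x], [y] and [A] only; products of [A] with [U] vanish. *)
Lemma small_abelian_line x y U z : 
  (forall v, exists s t, exists2 c, c \in A & v = s *: x + t *: y + c) ->
  (U <= A)%VS -> z \notin U -> (n <= \dim U + 3)%N ->
  (forall u, u \in U -> [br x, u] \in (U + <[z]>)%VS /\ [br u, x] \in (U + <[z]>)%VS) ->
  (forall u, u \in U -> [br y, u] \in (U + <[z]>)%VS /\ [br u, y] \in (U + <[z]>)%VS) ->
  (forall a, a \in A -> [br a, z] \in (U + <[z]>)%VS /\ [br z, a] \in (U + <[z]>)%VS) ->
  [br x, z] \in (U + <[z]>)%VS /\ [br z, x] \in (U + <[z]>)%VS ->
  [br y, z] \in (U + <[z]>)%VS /\ [br z, y] \in (U + <[z]>)%VS ->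
  (forall u, u \in U -> [br u, z] = 0 /\ [br z, u] = 0) -> [br z, z] = 0 ->
  small_abelian_ideal L n.
Proof.
move=> sp UA zU dU xU yU Az [xz zx] [yz zy] Uz zz.
set J := (U + <[z]>)%VS in xU yU Az xz zx yz zy.
have sUA u : u \in U -> u \in A by apply: (subvP UA).
apply: (small_abelian_idealI dL (J := J)).
- apply/idealP => v _ /memv_addP[u uU [_ /vlineP[k ->] ->]].
  have [s [t [c cA ->]]] := sp v.
  have [xu ux] := xU _ uU; have [yu uy] := yU _ uU; have [cz zc] := Az _ cA.
  by rewrite !brE (abA cA (sUA _ uU)) (abA (sUA _ uU) cA); split; memv_auto.
- apply/abelianP => _ _ /memv_addP[u uU [_ /vlineP[k ->] ->]] /memv_addP[w wU [_ /vlineP[l ->] ->]].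
  have [uz zu] := Uz _ uU; have [wz zw] := Uz _ wU.
  by rewrite !brE uz zw zz (abA (sUA _ uU) (sUA _ wU)) !scaler0 !addr0.
- by rewrite dim_add_line // addSn addn2 -addn3.
Qed.

(** If [A] is not an ideal, some [x = [br y, a]] leaves it. Adding [[br a, y]] gives [x'], which
    annihilates [L] from the left and is annihilated by [A]; the ideal is [A] plus the line of
    [x']. *)
Lemma left_trivial_case : (forall a v, a \in A -> [br a, v] \in A) -> small_abelian_ideal L n.
Proof.
move=> lA; have [[a [y [aA /negP xA]]]|nex] := classic (exists a y, a \in A /\ ~ [br y, a] \in A); last first.
  apply: (small_abelian_idealI dL (J := A)); rewrite ?dA //; last exact/abelianP.
  apply/idealP => v a aA; split; last exact: lA.
  by apply/negPn/negP => /negP vaA; apply: nex; exists a, v.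
set x := [br y, a] in xA; pose q := [br a, y]; have [x' x'E] : exists x', x' = x + q by exists (x + q).
have qA : q \in A by apply: lA.
have xbA b : b \in A -> [br x, b] \in A by move=> bA; rewrite br_rr // memvN lA.
have fr : free2 A x y.
  move=> s t stA; have t0 : t = 0.
    apply: (scaleK0 _ xA); apply: (memv_eq (memv_opp (memvZ s (xbA a aA)))).
    by have /eqP := abA stA aA; rewrite !brE -/x addrC addr_eq0 => /eqP.
  by split=> //; apply: (scaleK0 _ xA); move: stA; rewrite t0 scale0r addr0.
have x'l v : [br x', v] = 0 by rewrite x'E; apply: br_symm_kill.
have Ax' b : b \in A -> [br b, x'] = 0.
  by move=> bA; rewrite x'E brDr br_lr // (abA bA qA) addr0 abA // lA.
have sp v : exists s t, exists2 c, c \in A & v = s *: x' + t *: y + c.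
  have [s [t [c cA ->]]] := spanA fr v; exists s, t, (c - s *: q); first by memv_auto.
  by rewrite x'E; vring.
have x0 : x != 0 by apply: contraNneq xA => ->; rewrite mem0v.
apply: (small_abelian_line sp (subvv A) (z := x')).
- by apply: contraNN xA => x'A; apply: (memv_eq (memvB x'A qA)); rewrite x'E addrK.
- by rewrite -dA leq_add2l.
- by move=> u uA; rewrite x'l Ax' // !mem0v.
- move=> b bA; split; last exact/mem_addl/lA.
  have [s [t [c cA E]]] := sp [br y, b]; suff t0 : t = 0.
    by rewrite E t0 scale0r addr0; memv_auto; auto using mem_addl.
  have [// | t0] := eqVneq t 0; have ybA : [br y, b] \in A.
    rewrite -(memv_scaleE _ _ t0); apply: (memv_eq (memv_opp (lA b [br y, b] bA))).
    by rewrite -br_rr // E !brE x'l (abA cA bA) scaler0 add0r addr0 -E.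
  have [|_ -> //] := fr s t; apply: (memv_eq (memvB (memvB ybA cA) (memvZ s qA))).
  by rewrite E x'E; vring.
- by move=> u uA; rewrite x'l Ax' // !mem0v.
- by rewrite !x'l mem0v.
- rewrite x'l mem0v; split=> //.
  have [s [t [c cA E]]] := sp [br y, x']; suff t0 : t = 0.
    by rewrite E t0 scale0r addr0; memv_auto; auto using mem_addl.
  apply/eqP; have : [br [br y, x'], a] = 0 by rewrite leib_l x'l br0r x'l subrr.
  rewrite E !brE x'l (abA cA aA) -/x scaler0 add0r addr0 => /eqP.
  by rewrite scaler_eq0 (negPf x0) orbF.
- by move=> u uA; rewrite x'l Ax' .
- exact: x'l.
Qed.

Lemma dim_lker_line (f : 'End(L)) x : (forall b, b \in A -> exists k, f b = k *: x) ->
  (n <= \dim (A :&: lker f) + 3)%N.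
Proof.
move=> fx; have dk : (\dim A <= \dim (A :&: lker f) + \dim <[x]>)%N.
  by apply: codim_cap_lker => b /fx[k ->]; rewrite memvZ ?memv_line.
rewrite -dA (leq_trans (leq_add dk (leqnn 2))) // -addnA leq_add2l.
by rewrite dim_vline; case: (_ != _).
Qed.

Lemma add_self_eq0 (u : L) : u + u = 0 -> u = 0.
Proof.
by rewrite -mulr2n -scaler_nat => /eqP; rewrite scaler_eq0 (negPf two0) => /eqP.
Qed.

Definition left_singular := forall a, a \in A -> exists2 v, v \notin A & [br a, v] \in A.

(** Modulo [A], [a] is an idempotent, and the vectors fixed by its left multiplication form the line
    of [x]. Multiplications by [A] commute with it and preserve that line; the ideal is the line
    plus the left annihilator [A0] of [x] in [A]. *)
Lemma semisimple_case a x y : left_singular -> a \in A -> [br a, x] = x -> x \notin A ->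
  y \notin A -> [br a, y] \in A -> small_abelian_ideal L n.
Proof.
move=> sing aA ax xA yA; set w := [br a, y] => wA.
have fr : free2 A x y.
  move=> s t stA; have s0 : s = 0.
    apply: (scaleK0 _ xA); have := abA aA stA; rewrite !brE ax -/w => /eqP.
    by rewrite addr_eq0 => /eqP->; memv_auto.
  by split=> //; apply: (scaleK0 _ yA); move: stA; rewrite s0 scale0r add0r.
have sp := spanA fr.
have eig s t c : c \in A -> [br a, s *: x + t *: y + c] = s *: x + t *: w.
  by move=> cA; rewrite !brE ax (abA aA cA) addr0.
have fixa v : [br a, v] = v -> exists k, v = k *: x.
  have [s [t [c cA ->]]] := sp v; rewrite (eig _ _ _ cA) => E; exists s.
  have t0 : t = 0.
    apply: (scaleK0 _ yA); apply: (memv_eq (memvB (memvZ t wA) cA)).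
    by apply: (lincomb1 (a := -1) E); vring.
  have -> : c = 0 by apply: (lincomb1 (a := -1) E); rewrite t0; vring.
  by rewrite t0 scale0r !addr0.
have bx b : b \in A -> exists k, [br b, x] = k *: x.
  by move=> bA; apply: fixa; rewrite br_ll // ax.
have xb b : b \in A -> exists k, [br x, b] = k *: x.
  by move=> bA; apply: fixa; rewrite br_lr // ax.
pose A0 := (A :&: lker (ad_r x))%VS.
have A0P b : reflect (b \in A /\ [br b, x] = 0) (b \in A0).
  by rewrite memv_cap memv_ker ad_rE; apply: (iffP andP) => -[bA /eqP].
have A0A : (A0 <= A)%VS by apply: capvSl.
have x0 : x != 0 by apply: contraNneq xA => ->; rewrite mem0v.
have dA0 : (n <= \dim A0 + 3)%N.
  by apply: (dim_lker_line (x := x)) => b bA; have [k E] := bx b bA; exists k; rewrite ad_rE.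
have xA0 b : b \in A0 -> [br x, b] = 0.
  case/A0P=> bA bx0; have [k E] := xb b bA; have := br_rr x bA bA.
  rewrite E brZl brZr bx0 scaler0 oppr0 E scalerA => /eqP.
  by rewrite scaler_eq0 (negPf x0) orbF mulf_eq0 orbb => /eqP->; rewrite scale0r.
have byA b : b \in A -> [br b, y] \in A.
  move=> bA; have [s [t [c cA E]]] := sp [br b, y].
  have aby : [br a, [br b, y]] = 0 by rewrite br_ll // abA.
  rewrite E eig // in aby.
  have s0 : s = 0.
    by apply: (scaleK0 _ xA); move/eqP: aby; rewrite addr_eq0 => /eqP->; memv_auto.
  suff t0 : t = 0 by rewrite E s0 t0 !scale0r !add0r.
  (* Modulo [A], [b + (1 - k) *: a] has eigenvalue [1] at [x] and [t] at [y], so singularity forces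
     [t = 0]. *)
  have [k Ek] := bx b bA; have b'A : b + (1 - k) *: a \in A by memv_auto.
  have [v vA] := sing _ b'A.
  have [s' [t' [c' c'A vE]]] := sp v; rewrite vE in vA *.
  rewrite !brE (abA bA c'A) (abA aA c'A) Ek ax E -/w => mA.
  have [|s'0 tt'] := fr s' (t' * t).
    apply: (memv_eq (memvB mA (memvD (memvZ t' cA) (memvZ (1 - k) (memvZ t' wA))))).
    by rewrite s0; vring.
  apply/eqP; apply: contraNT vA => t0; move/eqP: tt'; rewrite mulf_eq0 (negPf t0) orbF => /eqP->.
  by rewrite s'0 !scale0r !add0r.
have ybA b : b \in A -> [br y, b] \in A.
  move=> bA; have [s [t [c cA E]]] := sp [br y, b].
  have ayb : [br a, [br y, b]] = 0 by rewrite br_lr // abA.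
  rewrite E eig // in ayb.
  have s0 : s = 0.
    by apply: (scaleK0 _ xA); move/eqP: ayb; rewrite addr_eq0 => /eqP->; memv_auto.
  suff t0 : t = 0 by rewrite E s0 t0 !scale0r !add0r.
  rewrite s0 scale0r add0r in E.
  have := br_rr y bA bA; rewrite E !brE (abA cA bA) (abA bA cA) !addr0 E => tt.
  have : (t * t) *: y \in A.
    apply: (memv_eq (memvB (memv_opp (memvZ t (byA b bA))) (memvZ t cA))).
    by rewrite -tt; vring.
  by move/scaleK0/(_ yA)/eqP; rewrite mulf_eq0 orbb => /eqP.
have xx : [br x, x] = 0.
  have [s [t [c cA E]]] := sp [br x, x].
  (* [a] acts on [[br x, x]] by two, which differs from its eigenvalues zero and one as the
     characteristic is not two. *)
  have e : [br a, [br x, x]] = [br x, x] + [br x, x] by rewrite leib ax.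
  rewrite E eig // in e.
  have [|s0 t0] := fr s (2%:R * t).
    apply: (memv_eq (memvB (memvZ t wA) (memvD cA cA))).
    apply: (lincomb1 (a := -1) e); vring.
  move/eqP: t0; rewrite mulf_eq0 (negPf two0) => /eqP t0.
  rewrite E s0 t0 !scale0r !add0r; apply: add_self_eq0.
  by rewrite s0 t0 !scale0r !add0r in e.
have wA0 : w \in A0 /\ exists k, [br y, x] = k *: x.
  (* The Leibniz identity gives [[a, [y, x]] = k x + [y, x]]; comparing components modulo [A] kills
     [k] and the [y]-component of [[br y, x]]. *)
  have [k wx] := bx w wA; have e := leib a y x; rewrite -/w ax wx in e.
  have [s [t [c cA E]]] := sp [br y, x]; have e' := e; rewrite E eig // in e'.
  have [|k0 t0] := fr k t.
    by apply: (memv_eq (memvB (memvZ t wA) cA)); apply: (lincomb1 (a := -1) e'); vring.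
  split; last by apply: fixa; rewrite e k0 scale0r add0r.
  by apply/A0P; rewrite wx k0 scale0r.
case: wA0 => wA0 [k yx].
have xy : exists l, [br x, y] = l *: x.
  by apply: fixa; rewrite leib ax -/w (xA0 _ wA0) addr0.
case: xy => l xy.
have A0y b : b \in A0 -> [br b, y] \in A0.
  case/A0P => bA bx0; apply/A0P; split; first exact: byA.
  by rewrite leib_l yx bx0 brZr bx0 br0r scaler0 subrr.
have yA0 b : b \in A0 -> [br y, b] \in A0.
  case/A0P => bA bx0; apply/A0P; split; first exact: ybA.
  by rewrite leib_l yx bx0 brZr bx0 br0r scaler0 subrr.
apply: (small_abelian_line sp A0A (z := x)) => //.
- by apply: contra xA; apply: (subvP A0A).
- move=> u uA0; have /A0P[uA ux] := uA0; rewrite (xA0 u uA0) ux mem0v; by split.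
- by move=> u uA0; split; apply: mem_addl; auto.
- by move=> b bA; have [k1 ->] := bx b bA; have [k2 ->] := xb b bA; split; memv_auto.
- by rewrite xx mem0v.
- by rewrite xy yx; split; memv_auto.
- by move=> u uA0; have /A0P[] := uA0; rewrite (xA0 u uA0).
Qed.

(** * Left action of [A] on [L / A] through a line of nilpotent maps *)

Section Nilpotent.
Variables a x y u : L.
Hypotheses (aA : a \in A) (ay : [br a, y] = x) (ax : [br a, x] = u) (uA : u \in A).
Hypothesis fr : free2 A x y.
Hypothesis Ay : forall b, b \in A ->
  exists s, exists2 c, c \in A & [br b, y] = s *: x + c /\ [br b, x] = s *: u.
Hypothesis yA : forall b, b \in A ->
  exists s, exists2 c, c \in A & [br y, b] = s *: x + c /\ [br x, b] = s *: u.

Let sp := spanA fr.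

Let xA : x \notin A.
Proof.
apply/negP => xA; case: (fr (a := 1) (b := 0)).
  by rewrite scale1r scale0r addr0.
by move/eqP; rewrite oner_eq0.
Qed.

Let x0 : x != 0. Proof. by apply: contraNneq xA => ->; rewrite mem0v. Qed.

(** Here [A] and [x] annihilate each other, and the ideal is [A] plus the line of [x]. The square
    [[br x, x]] equals [t *: x], and [t^2 = 0] since squares annihilate from the left. *)
Lemma nilpotent_trivial : u = 0 -> small_abelian_ideal L n.
Proof.
move=> u0; have Ax b : b \in A -> [br b, x] = 0.
  by move=> bA; have [s [c cA [_ ->]]] := Ay bA; rewrite u0 scaler0.
have xbA b : b \in A -> [br x, b] = 0.
  by move=> bA; have [s [c cA [_ ->]]] := yA bA; rewrite u0 scaler0.
have [s [t [c cA E]]] := sp [br y, x].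
have xx : [br x, x] = t *: x.
  by rewrite -{1}ay leib_l ax u0 br0r subr0 E !brE ax u0 ay (abA aA cA) scaler0 add0r addr0.
have t0 : t = 0.
  have := br_sq_kill x x; rewrite xx brZl xx scalerA => /eqP.
  by rewrite scaler_eq0 (negPf x0) orbF mulf_eq0 orbb => /eqP.
rewrite t0 scale0r in xx; rewrite t0 scale0r addr0 in E.
have aL v : [br a, v] \in (A + <[x]>)%VS.
  have [s' [t' [c' c'A ->]]] := sp v; rewrite !brE ax u0 ay (abA aA c'A); memv_auto.
have yx : [br y, x] \in (A + <[x]>)%VS by rewrite E; memv_auto.
apply: (small_abelian_line sp (subvv A) (z := x)) => //.
- by rewrite -dA leq_add2l.
- by move=> b bA; rewrite Ax ?xbA ?mem0v.
- move=> b bA; have [s1 [c1 c1A [-> _]]] := yA bA; have [s2 [c2 c2A [-> _]]] := Ay bA.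
  by split; memv_auto.
- by move=> b bA; rewrite Ax ?xbA ?mem0v.
- by rewrite xx mem0v.
- split=> //; rewrite -{1}ay leib_l ay; apply: memvB => //; exact: aL.
- by move=> b bA; rewrite Ax ?xbA.
Qed.

Hypothesis u0 : u != 0.

Let A0 := (A :&: lker (ad_r x))%VS.
Let A0P b : reflect (b \in A /\ [br b, x] = 0) (b \in A0).
Proof. by rewrite memv_cap memv_ker ad_rE; apply: (iffP andP) => -[bA /eqP]. Qed.
Let A0A : (A0 <= A)%VS. Proof. exact: capvSl. Qed.
Let dA0 : (n <= \dim A0 + 3)%N.
Proof.
by apply: (dim_lker_line (x := u)) => b bA; have [k [c cA [_ E]]] := Ay bA; exists k; rewrite ad_rE.
Qed.

Let A0y b : b \in A0 -> [br b, y] \in A.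
Proof.
case/A0P => bA; have [s [c cA [-> ->]]] := Ay bA => /eqP.
by rewrite scaler_eq0 (negPf u0) orbF => /eqP->; rewrite scale0r add0r.
Qed.

(** [x' = [br a, y] + [br y, a]] annihilates [L] from the left and agrees with [x] modulo [A]. Its
    line and [A0] form the ideal, once Leibniz identities place [[br y, x']] in it. *)
Lemma nilpotent_right_trivial : (forall b, b \in A -> [br x, b] = 0) -> small_abelian_ideal L n.
Proof.
move=> xb0; have ybA b : b \in A -> [br y, b] \in A.
  move=> bA; have := xb0 b bA; have [s [c cA [-> ->]]] := yA bA => /eqP.
  by rewrite scaler_eq0 (negPf u0) orbF => /eqP->; rewrite scale0r add0r.
pose q := [br y, a]; have qA : q \in A by apply: ybA.
have [x' x'E] : exists x', x' = x + q by exists (x + q).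
have x'l v : [br x', v] = 0 by rewrite x'E -ay /q; apply: br_symm_kill.
have Ax' b : b \in A -> [br b, x'] = [br b, x].
  by move=> bA; rewrite x'E brDr (abA bA qA) addr0.
have sp' v : exists s t, exists2 c, c \in A & v = s *: x' + t *: y + c.
  have [s [t [c cA ->]]] := sp v; exists s, t, (c - s *: q); first by memv_auto.
  by rewrite x'E; vring.
have ux : u \in A0.
  have e := leib_l a x' y; rewrite x'l br0r sub0r ay (Ax' _ aA) ax x'l oppr0 in e.
  apply/A0P; split=> //; have [s [c cA [E ->]]] := Ay uA.
  rewrite E in e; suff -> : s = 0 by rewrite scale0r.
  by apply: (scaleK0 _ xA); move/eqP: e; rewrite addr_eq0 => /eqP->; memv_auto.
have [s [t [c cA E]]] := sp' [br y, x'].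
have t0 : t = 0.
  have e := leib a y x'; rewrite ay (Ax' _ aA) ax E !brE (Ax' _ aA) ax ay (abA aA cA) in e.
  apply: (scaleK0 _ xA); have [k [d dA' [_ Ek]]] := Ay qA.
  have xx' : [br x, x'] = - (k *: u).
    by rewrite -Ek -(Ax' _ qA) -[x](addrK q) -x'E !brE x'l sub0r.
  rewrite xx' in e; apply: (memv_eq (memvB (memvB (ybA u uA) (memvZ k uA)) (memvZ s uA))).
  by apply: (lincomb1 (a := 1) e); vring.
rewrite t0 scale0r addr0 in E.
have cA0 : c \in A0.
  have e := leib_l y x' y; rewrite x'l x'l br0r subrr E !brE x'l scaler0 add0r in e.
  apply/A0P; split=> //; have [k [d dA' [Ek ->]]] := Ay cA.
  rewrite Ek in e; suff -> : k = 0 by rewrite scale0r.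
  by apply: (scaleK0 _ xA); move/eqP: e; rewrite addr_eq0 => /eqP->; memv_auto.
have A0x' b : b \in A0 -> [br b, x'] = 0 by case/A0P => bA; rewrite Ax'.
apply: (small_abelian_line sp' A0A (z := x')) => //.
- apply: contra xA => /(subvP A0A) x'A; apply: (memv_eq (memvB x'A qA)); rewrite x'E addrK //.
- by move=> b bA0; rewrite x'l A0x' ?mem0v.
- move=> b bA0; have /A0P[bA _] := bA0; split; apply: mem_addl; apply/A0P.
    by rewrite ybA // -Ax' ?ybA // leib_l A0x' // br0r E !brE !A0x' // (abA bA cA) scaler0 addr0 subrr.
  by rewrite A0y // -Ax' ?A0y // leib_l E !brE !A0x' // (abA bA cA) br0r scaler0 addr0 subrr.
- move=> b bA; rewrite x'l mem0v; split=> //; rewrite Ax' //.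
  by have [k [d dA' [_ ->]]] := Ay bA; memv_auto.
- by rewrite x'l mem0v.
- by rewrite x'l mem0v E; split; memv_auto.
- by move=> b bA0; rewrite x'l A0x'.
Qed.

(** * Nilpotent left action with opposite right action *)

Section Skew.
Hypothesis skewA : forall b, b \in A -> [br x, b] = - [br b, x].

Let xA0 b : b \in A0 -> [br x, b] = 0.
Proof. by case/A0P => bA bx; rewrite skewA // bx oppr0. Qed.

Let yA0 b : b \in A0 -> [br y, b] \in A.
Proof.
move=> bA0; have := xA0 bA0; have /A0P[bA _] := bA0.
have [s [c cA [-> ->]]] := yA bA => /eqP.
by rewrite scaler_eq0 (negPf u0) orbF => /eqP->; rewrite scale0r add0r.
Qed.

Let yaE : exists2 q, q \in A & [br y, a] = - x + q.
Proof.
have [s [c cA [E xaE]]] := yA aA; exists c; rewrite // E.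
suff -> : s = -1 by rewrite scaleN1r.
apply/eqP; rewrite -addr_eq0; move/eqP: xaE; rewrite skewA // ax -subr_eq0 -opprD oppr_eq0.
by rewrite -[X in X + _]scale1r -scalerDl scaler_eq0 (negPf u0) orbF addrC.
Qed.

(** In [w = s *: x + t *: y + c], the equation [[br w, a] = 0] removes first [t], then [s]. Hence
    all squares and all symmetrized products lie in [A0]. *)
Lemma left_annihilator_A0 w : (forall v, [br w, v] = 0) -> w \in A0.
Proof.
move=> wl; have [s [t [c cA E]]] := sp w; have [q qA ya] := yaE.
have := wl a; rewrite E !brE skewA // ax ya (abA cA aA) addr0 => wa.
have t0 : t = 0.
  apply: (scaleK0 _ xA); apply: (memv_eq (memvB (memvZ t qA) (memvZ s uA))).
  by apply: (lincomb1 (a := -1) wa); vring.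
rewrite -E; move/eqP: wa; rewrite t0 scale0r addr0 scalerN oppr_eq0 scaler_eq0 (negPf u0) orbF => /eqP s0.
by apply/A0P; rewrite wl E s0 t0 !scale0r !add0r.
Qed.

Let symm v w : [br v, w] + [br w, v] \in A0.
Proof. by apply: left_annihilator_A0 => z; apply: br_symm_kill. Qed.

Let sqv v : [br v, v] \in A0.
Proof. by apply: left_annihilator_A0 => z; apply: br_sq_kill. Qed.

Let uE : exists t, [br u, x] = t *: u /\ u - t *: a \in A0.
Proof.
have [t [c cA [_ E]]] := Ay uA; exists t; split=> //; apply/A0P.
by split; [memv_auto | rewrite !brE E ax subrr].
Qed.

Let dimA0 : (\dim A0 + 3 = n)%N.
Proof.
apply/eqP; rewrite eqn_leq dA0 andbT -dA (addnS _ 2) -addSn leq_add2r ltn_neqAle dimvS // andbT.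
apply: contra u0 => /eqP dAA; have AA0 : A0 = A by apply/eqP; rewrite eqEdim A0A dAA leqnn.
by have := aA; rewrite -AA0 => /A0P[_]; rewrite ax => ->.
Qed.

(* The coefficient of y in [y, x] comes from comparing two expressions for [x, x]. *)
Let yxE t : [br u, x] = t *: u ->
  exists s, exists2 d, d \in A & [br y, x] = s *: x - t *: y + d /\
    [br x, x] = s *: u - t *: x - [br y, u].
Proof.
move=> ux; have [s [k [d dA' E]]] := sp [br y, x].
have xx : [br x, x] = s *: u + k *: x - [br y, u].
  by rewrite -{1}ay leib_l ax E !brE ax ay (abA aA dA') addr0.
suff kt : k = - t by exists s, d; rewrite // -!scaleNr -kt.
have [l [c cA [yu xu]]] := yA uA.
have lt : l = - t.
  apply/eqP; rewrite -addr_eq0; move/eqP: xu; rewrite skewA // ux -subr_eq0 -scaleNr -scalerBl.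
  by rewrite scaler_eq0 (negPf u0) orbF -opprD oppr_eq0 addrC.
have /A0P[xxA _] := sqv x; apply/eqP; rewrite -lt -subr_eq0; apply/eqP.
apply: (scaleK0 _ xA); apply: (memv_eq (memvB (memvD xxA cA) (memvZ s uA))).
by rewrite xx yu; vring.
Qed.

(** The Heisenberg situation has [B = A + <x>], [Z = A0] and outer element [y]: the products of [A]
    with [x] lie on the line of [u], which is now inside [A0]. *)
Lemma nilpotent_heisenberg : u \in A0 -> small_abelian_ideal L n \/ heisenberg_case L n.
Proof.
move=> uA0; have /A0P[_ ux] := uA0; have [q qA ya] := yaE.
have [|s [d dA' [yx xx]]] := @yxE 0; first by rewrite scale0r.
rewrite scale0r subr0 in yx; rewrite scale0r subr0 in xx.
have qE : q = [br y, a] + [br a, y] by rewrite ya ay; vring.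
have qA0 : q \in A0 by rewrite qE symm.
have [z [zA xyE]] : exists z, z \in A /\ [br x, y] = z - (s *: x + d).
  exists ([br x, y] + [br y, x]); split; first exact: (subvP A0A).
  by rewrite -yx addrK.
(* Two Leibniz expansions give [[br x, x]] with opposite signs, so its double is zero. *)
have xx0 : [br x, x] = 0.
  apply: add_self_eq0; have e := leib x y a.
  rewrite ya xyE !brE (skewA aA) (xA0 qA0) ax (abA zA aA) (abA dA' aA) brNr in e.
  rewrite {1}xx; apply: (lincomb1 (a := -1) e); vring.
have sBA v : v \in A -> v \in (A + <[x]>)%VS by apply: mem_addl.
have Bx : x \in (A + <[x]>)%VS by apply: mem_addr.
apply: (@heisenberg_or_small _ _ _ (A + <[x]>)%VS A0 y) => //.
- by rewrite dim_add_line // -dA -addn1 -addnA.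
- by apply: subv_trans A0A (addvSl _ _).
- apply/memv_add_lineP => -[k ykx]; case: (fr (a := - k) (b := 1)).
    by apply: (memv_eq ykx); vring.
  by move=> _ /eqP; rewrite oner_eq0.
- move=> v _ vA0 /memv_addP[c cA [_ /vlineP[k ->] ->]]; have /A0P[vA vx] := vA0.
  by rewrite !brE (xA0 vA0) vx (abA vA cA) (abA cA vA) !scaler0 !addr0.
- move=> _ _ /memv_addP[c cA [_ /vlineP[k ->] ->]] /memv_addP[c' c'A [_ /vlineP[k' ->] ->]].
  have [l [e _ [_ cx]]] := Ay cA; have [l' [e' _ [_ cx']]] := Ay c'A.
  by rewrite !brE (abA cA c'A) xx0 (skewA c'A) cx cx'; memv_auto.
- move=> _ /memv_addP[c cA [_ /vlineP[k ->] ->]].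
  by rewrite !brE (abA cA cA) xx0 (skewA cA); vring.
- move=> _ /memv_addP[c cA [_ /vlineP[k ->] ->]].
  by have [l [e eA [yc _]]] := yA cA; rewrite !brE yc yx; memv_auto; auto.
- move=> v vA0; have /A0P[vA vx] := vA0; apply/A0P; split; first exact: yA0.
  by rewrite leib_l vx yx br0r !brE vx (abA vA dA') scaler0 addr0 subrr.
Qed.

(** With [t] non-zero, [A0] is central and the error terms [s], [z], [q] and [[br y, y]] vanish one
    after the other. After a change of basis what remains is [d(m)] for the diagonal [m] with
    entries [-t] and [t]. *)
Lemma nilpotent_simple t : t != 0 -> [br u, x] = t *: u -> u - t *: a \in A0 -> simple_case L n.
Proof.
move=> t0 ux u0A; have [q qA ya] := yaE.
have [s [d dA' [yx xx]]] := yxE ux.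
have qE : q = [br y, a] + [br a, y] by rewrite ya ay; vring.
have qA0 : q \in A0 by rewrite qE symm.
have two_t0 : 2%:R * t != 0 by rewrite mulf_neq0.
have A0y0 b : b \in A0 -> [br b, y] = 0.
  move=> bA0; have /A0P[bA bx] := bA0; have byA := A0y bA0.
  have e := leib b y x; rewrite bx br0r addr0 yx !brE bx (abA bA dA') in e.
  have [l [c _ [_ E]]] := Ay byA; rewrite E in e.
  have tby : t *: [br b, y] = - (l *: u) by apply: (lincomb1 (a := -1) e); vring.
  have l0 : l = 0.
    (* Right multiplication by [x] turns the two sides of [tby] into [t l u] and [- t l u]. *)
    have := congr1 (fun v => [br v, x]) tby; rewrite /= !brE E ux => e2.
    have : (2%:R * t * l) *: u = 0 by apply: (lincomb1 (a := 1) e2); vring.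
    by move/eqP; rewrite scaler_eq0 mulf_eq0 (negPf u0) (negPf two_t0) orbF => /eqP.
  by move/eqP: tby; rewrite l0 scale0r oppr0 scaler_eq0 (negPf t0) => /eqP.
have [z [zA0 xyE]] : exists z, z \in A0 /\ [br x, y] = z - [br y, x].
  by exists ([br x, y] + [br y, x]); rewrite addrK symm.
have yA00 b : b \in A0 -> [br y, b] = 0.
  move=> bA0; have /A0P[bA bx] := bA0.
  have ybA0 : [br y, b] \in A0 by have := symm y b; rewrite (A0y0 _ bA0) addr0.
  have /A0P[zA _] := zA0; have e := leib x y b.
  rewrite (xA0 ybA0) (xA0 bA0) br0r addr0 xyE yx !brE (xA0 bA0) (abA zA bA) (abA dA' bA) in e.
  have : t *: [br y, b] = 0 by apply: (lincomb1 (a := -1) e); vring.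
  by move/eqP; rewrite scaler_eq0 (negPf t0) => /eqP.
have A0c b : b \in A0 -> forall v, [br b, v] = 0 /\ [br v, b] = 0.
  move=> bA0 v; have /A0P[bA bx] := bA0; have [l [k [c cA ->]]] := sp v.
  rewrite !brE bx (abA bA cA) (abA cA bA) (xA0 bA0) (A0y0 _ bA0) (yA00 _ bA0).
  by rewrite !scaler0 !addr0.
have [w [wA0 uE']] : exists w, w \in A0 /\ u = t *: a + w.
  by exists (u - t *: a); split; last vring.
have yu : [br y, u] = - (t *: x) + t *: q.
  by rewrite uE' brDr brZr ya (yA00 _ wA0); vring.
have xxE : [br x, x] = s *: u - t *: q by rewrite xx yu; vring.
have s0 : s = 0.
  have /A0P[_] : s *: u \in A0.
    apply: (memv_eq (memvD (sqv x) (memvZ t qA0))); rewrite xxE; vring.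
  rewrite brZl ux scalerA => /eqP.
  by rewrite scaler_eq0 (negPf u0) orbF mulf_eq0 (negPf t0) orbF => /eqP.
rewrite s0 scale0r sub0r in xxE; rewrite s0 scale0r sub0r in yx.
have z0 : z = 0.
  have e := leib a y y; rewrite ay xyE in e; have [_ ae] := A0c _ (sqv y) a.
  by rewrite ae subrK in e.
rewrite z0 sub0r in xyE.
have q0 : q = 0.
  have e := leib a x y; rewrite ax ay xyE xxE yx uE' !brE ay (abA aA dA') in e.
  have [wy _] := A0c _ wA0 y; rewrite wy in e.
  have : t *: q = 0 by apply: (lincomb1 (a := 1) e); vring.
  by move/eqP; rewrite scaler_eq0 (negPf t0) => /eqP.
rewrite q0 scaler0 oppr0 in xxE; rewrite q0 addr0 in ya.
have [r [d' [d'A0 dE]]] : exists r d', d' \in A0 /\ d = r *: a + d'.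
  have [r [c cA [_ dx]]] := Ay dA'; exists r, (d - r *: a).
  split; last by vring.
  by apply/A0P; split; [memv_auto | rewrite !brE dx ax subrr].
have [d'y yd'] := A0c _ d'A0 y.
have yy : [br y, y] = 0.
  have e := leib x y y; have [_ xe] := A0c _ (sqv y) x.
  rewrite xe xyE yx dE !brE ay ya d'y yd' in e.
  have : (2%:R * t) *: [br y, y] = 0 by apply: (lincomb1 (a := -1) e); vring.
  by move/eqP; rewrite scaler_eq0 (negPf two_t0) => /eqP.
have [wx xw] := A0c _ wA0 x; have [wy yw] := A0c _ wA0 y.
have [d'x xd'] := A0c _ d'A0 x; have [d'a ad'] := A0c _ d'A0 a; have [wa aw] := A0c _ wA0 a.
have [d'd' _] := A0c _ d'A0 d'; have [wd' d'w] := A0c _ wA0 d'; have [ww _] := A0c _ wA0 w.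
have xa : [br x, a] = - u by rewrite skewA // ax.
have aa := abA aA aA.
(* The h, x, y of d(m) are x, u/t and y - d/t + (r/2t) u/t. *)
apply: (@simple_caseI _ _ _ (- t) 0 0 x (a + t^-1 *: w)
  (y - t^-1 *: (r *: a + d') + (r / (2%:R * t)) *: (a + t^-1 *: w)) A0 _ dL dimA0 A0c).
pose E := (xyE, yx, dE, xa, ax, uE', xw, wx, xd', d'x, d'y, yd', ay, ya, yw, wy, yy, ad', d'a, aw, wa,
  d'd', wd', d'w, ww, aa).
split; last by rewrite x0 mulr0 addr0 expf_neq0 ?oppr_eq0.
all: split; rewrite ?xxE ?q0 ?brE ?E.
all: rewrite ?brE ?E; apply: coordvP => i; rewrite !coordvE; field; rewrite ?t0 ?two0 //.
Qed.

Lemma nilpotent_skew : small_abelian_ideal L n \/ (simple_case L n \/ heisenberg_case L n).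
Proof.
have [t [ux uA0]] := uE; have [t0 | t0] := eqVneq t 0; last first.
  by right; left; apply: nilpotent_simple t0 ux uA0.
rewrite t0 scale0r subr0 in uA0.
by have [] := nilpotent_heisenberg uA0; [left | right; right].
Qed.

End Skew.

End Nilpotent.

(** Commuting with [a], each [b] in [A] acts on [L / A] as [s] times the nilpotent map plus a scalar
    [t]. Singularity kills [t] on the left, and [br_rr] gives [t^2 = 0] on the right. *)
Lemma nilpotent_case a y : left_singular -> a \in A -> [br a, y] \notin A ->
  [br a, [br a, y]] \in A -> small_abelian_ideal L n \/ (simple_case L n \/ heisenberg_case L n).
Proof.
move=> sing aA xA uA; have [x xE] : exists x, [br a, y] = x by exists [br a, y].
have [u uE] : exists u, [br a, x] = u by exists [br a, x].
rewrite xE uE in xA uA.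
have fr : free2 A x y.
  move=> s t stA; have t0 : t = 0.
    apply: (scaleK0 _ xA); apply: (memv_eq (memv_opp (memvZ s uA))).
    by have /eqP := abA aA stA; rewrite !brE uE xE addrC addr_eq0 => /eqP.
  by split=> //; apply: (scaleK0 _ xA); move: stA; rewrite t0 scale0r addr0.
have sp := spanA fr.
have Ay b : b \in A ->
    exists s, exists2 c, c \in A & [br b, y] = s *: x + c /\ [br b, x] = s *: u.
  move=> bA; have [s [t [c cA E]]] := sp [br b, y].
  have bx : [br b, x] = s *: u + t *: x.
    by rewrite -xE br_ll // E !brE uE xE (abA aA cA) addr0.
  suff t0 : t = 0.
    by exists s, c; rewrite // E bx t0 !scale0r !addr0.
  have [v vA] := sing _ bA; have [s' [t' [c' c'A vE]]] := sp v.
  rewrite vE !brE bx E (abA bA c'A) addr0 => mA.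
  have [|e1 e2] := fr (s' * t + t' * s) (t' * t).
    apply: (memv_eq (memvB (memvB mA (memvZ (s' * s) uA)) (memvZ t' cA))); vring.
  have [// | t0] := eqVneq t 0; case/negP: vA; rewrite vE.
  move/eqP: e2; rewrite mulf_eq0 (negPf t0) orbF => /eqP t'0.
  move/eqP: e1; rewrite t'0 mul0r addr0 mulf_eq0 (negPf t0) orbF => /eqP ->.
  by rewrite !scale0r !add0r.
have yA b : b \in A ->
    exists s, exists2 c, c \in A & [br y, b] = s *: x + c /\ [br x, b] = s *: u.
  move=> bA; have [s [t [c cA E]]] := sp [br y, b].
  have xb : [br x, b] = s *: u + t *: x.
    by rewrite -xE -br_lr // E !brE uE xE (abA aA cA) addr0.
  suff t0 : t = 0.
    by exists s, c; rewrite // E xb t0 !scale0r !addr0.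
  have := br_rr y bA bA; have [l [d dA' [by_ bx]]] := Ay b bA.
  rewrite E !brE xb bx by_ E (abA cA bA) (abA bA cA) => e.
  have [|_ tt] := fr (s * t + t * s + t * l) (t * t).
    apply: (memv_eq (memvB (memvB (memvB (memv_opp (memvZ (s * l) uA)) (memvZ t dA'))
      (memvZ (s * s) uA)) (memvZ t cA))).
    by apply: (lincomb1 (a := 1) e); vring.
  by move/eqP: tt; rewrite mulf_eq0 orbb => /eqP.
have [u0 | u0] := eqVneq u 0; first by left; apply: (nilpotent_trivial aA xE uE) u0.
(* The vanishing of the product of [[br y, b] + [br b, y]] with [b'] reads [(s + l) s' u = 0]. So
   either all of [A] annihilates [x] from the right, or the right action on [x] is everywhere
   opposite to the left one. *)
have alt b b' : b \in A -> b' \in A -> [br x, b] = - [br b, x] \/ [br x, b'] = 0.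
  move=> bA b'A; have [s [c cA [yb xb]]] := yA b bA; have [l [d dA' [by_ bx]]] := Ay b bA.
  have [s' [c' c'A [yb' xb']]] := yA b' b'A.
  have := br_symm_kill y b b'; rewrite yb by_ !brE xb' (abA cA b'A) (abA dA' b'A).
  rewrite !addr0 !scalerA -scalerDl -mulrDl => /eqP.
  rewrite scaler_eq0 (negPf u0) orbF mulf_eq0 => /orP[] /eqP e.
    by left; rewrite xb bx -scaleNr; congr (_ *: _); apply/eqP; rewrite -addr_eq0 e.
  by right; rewrite e scale0r.
have [xA0 | /not_all_ex_not[b' nb']] := classic (forall b, b \in A -> [br x, b] = 0).
  by left; apply: (nilpotent_right_trivial aA xE uE uA fr Ay yA u0 xA0).
have b'A : b' \in A by apply/negPn/negP => /negP b'A; apply: nb' => /b'A.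
apply: (nilpotent_skew aA xE uE uA fr Ay yA u0) => b bA.
by case: (alt b b' bA b'A) => // b'0; case: nb'.
Qed.

(** A singular [a] with [[br a, w]] outside [A] has rank one and trace [s] on [L / A]: it is
    nilpotent if [s = 0] and a multiple of an idempotent otherwise. *)
Lemma singular_case : left_singular ->
  small_abelian_ideal L n \/ (simple_case L n \/ heisenberg_case L n).
Proof.
move=> sing; have [[a [w [aA /negP awA]]] | nex] :=
    classic (exists a w, a \in A /\ ~ [br a, w] \in A); last first.
  left; apply: left_trivial_case => a v aA.
  by apply/negPn/negP => /negP avA; apply: nex; exists a, v; split=> //; apply/negP.
have [v vA avA] := sing a aA.
have fr : free2 A w v.
  move=> s t stA; have s0 : s = 0.
    apply: (scaleK0 _ awA); apply: (memv_eq (memv_opp (memvZ t avA))).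
    by have /eqP := abA aA stA; rewrite !brE addr_eq0 => /eqP.
  by split=> //; apply: (scaleK0 _ vA); move: stA; rewrite s0 scale0r add0r.
have [s [t [c cA E]]] := spanA fr [br a, w].
have aaw : [br a, [br a, w]] = s *: [br a, w] + t *: [br a, v].
  by rewrite {1}E !brE (abA aA cA) addr0.
have [s0 | s0] := eqVneq s 0.
  by apply: (nilpotent_case sing aA awA); rewrite aaw s0 scale0r add0r memvZ.
(* The second term makes [x] an exact eigenvector in [L], not only modulo [A]. *)
left; pose x := [br a, w] + (t / s) *: [br a, v].
have axE : [br a, x] = s *: x.
  rewrite /x !brE aaw (abA aA avA) scaler0 addr0 scalerDr scalerA; congr (_ + _ *: _); field.
  exact: s0.
apply: (@semisimple_case (s^-1 *: a) x v sing) => //.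
- exact: memvZ.
- by rewrite brZl axE scalerK.
- apply: contra awA => xA'; apply: (memv_eq (memvB xA' (memvZ (t / s) avA))).
  by rewrite /x addrK.
- by rewrite brZl memvZ.
Qed.

End CodimensionTwo.

(** * An element of A acting invertibly on L / A *)

Section NonSingular.
Variables (F : fieldType) (L : leibnizType F) (n : nat) (A : {vspace L}).
Hypotheses (two0 : (2%:R : F) != 0) (dL : \dim {:L} = n) (dA : (\dim A + 2 = n)%N).
Hypothesis abA : {in A &, forall a b, [br a, b] = 0}.
Variable a0 : L.
Hypotheses (a0A : a0 \in A) (a0inj : forall v, [br a0, v] \in A -> v \in A).
Implicit Types (a b c : L) (U : {vspace L}).

Let W : {vspace L} := limg (ad_l a0).

Let kerA : lker (ad_l a0) = A.
Proof.
apply/vspaceP => v; rewrite memv_ker ad_lE; apply/eqP/idP => [av | vA]; last exact: abA.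
by apply: a0inj; rewrite av mem0v.
Qed.

Let dW : \dim W = 2.
Proof.
have := limg_ker_dim (ad_l a0) fullv; rewrite capfv kerA dL -dA => /eqP.
by rewrite eqn_add2l => /eqP.
Qed.

Let memW v : [br a0, v] \in W.
Proof. by rewrite -ad_lE memv_img ?memvf. Qed.

Let WA w : w \in W -> w \in A -> w = 0.
Proof. by case/memv_imgP => v _ ->; rewrite ad_lE => /a0inj vA; apply: abA. Qed.

Let injW w : w \in W -> [br a0, w] = 0 -> w = 0.
Proof. by move=> wW aw; apply: WA => //; apply: a0inj; rewrite aw mem0v. Qed.

Let lW b w : b \in A -> w \in W -> [br b, w] \in W.
Proof. by move=> bA /memv_imgP[v _ ->]; rewrite ad_lE (br_ll abA) ?memW. Qed.

Let rW b w : b \in A -> w \in W -> [br w, b] \in W.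
Proof. by move=> bA /memv_imgP[v _ ->]; rewrite ad_lE -(br_lr abA) ?memW. Qed.

Let capAW : (A :&: W = 0)%VS.
Proof.
apply/eqP; rewrite -subv0; apply/subvP => w /memv_capP[wA wW].
by rewrite memv0 (WA wW wA).
Qed.

Let splitW v : exists2 a, a \in A & exists2 w, w \in W & v = a + w.
Proof.
suff /eqP AW : (A + W)%VS == fullv.
  by have := memvf v; rewrite -AW => /memv_addP[a aA [w wW ->]]; exists a => //; exists w.
by rewrite eqEdim subvf dimv_disjoint_sum //= dW dL dA.
Qed.

Let surjW w : w \in W -> exists2 w', w' \in W & w = [br a0, w'].
Proof.
case/memv_imgP => v _ ->; have [a aA [w' w'W ->]] := splitW v.
by exists w'; rewrite // ad_lE brDr (abA a0A aA) add0r.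
Qed.

Let basisW x : x \in W -> x != 0 -> exists2 y, y \in W & free2 A x y.
Proof.
move=> xW x0; have [y yW yx] : exists2 y, y \in W & y \notin <[x]>%VS.
  by apply/subvPn/negP => /dimvS; rewrite dW dim_vline x0.
exists y => // s t stA; have st0 := WA (memvD (memvZ s xW) (memvZ t yW)) stA.
have t0 : t = 0.
  apply: (scaleK0 _ yx); apply: (memv_eq (memv_opp (memvZ s (memv_line x)))).
  by apply/eqP; rewrite -addr_eq0 addrC st0.
split=> //; move/eqP: st0; rewrite t0 scale0r addr0 scaler_eq0 (negPf x0) orbF.
by move/eqP.
Qed.

Let exW : exists x y, [/\ x \in W, y \in W & free2 A x y].
Proof.
have xW : vpick W \in W by apply: memv_pick.
have x0 : vpick W != 0 by rewrite vpick0 -dimv_eq0 dW.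
by have [y yW fr] := basisW xW x0; exists (vpick W), y.
Qed.

Let spanW x y : x \in W -> y \in W -> free2 A x y ->
  forall w, w \in W -> exists s t, w = s *: x + t *: y.
Proof.
move=> xW yW fr w wW; have [s [t [c cA E]]] := spanA dL dA fr w; exists s, t.
rewrite E (_ : c = 0) ?addr0 //; apply: WA => //.
apply: (memv_eq (memvB (memvB wW (memvZ s xW)) (memvZ t yW))); rewrite E; vring.
Qed.

Let fr0 x y s t : free2 A x y -> s *: x + t *: y = 0 -> s = 0 /\ t = 0.
Proof. by move=> fr st0; apply: fr; rewrite st0 mem0v. Qed.

Let small_abelian_sum U : (U <= A)%VS -> (n <= \dim U + 4)%N ->
  (forall b w, b \in U -> w \in W -> [br b, w] = 0 /\ [br w, b] = 0) ->
  (forall w w', w \in W -> w' \in W -> [br w, w'] = 0) -> small_abelian_ideal L n.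
Proof.
move=> UA dU UW WW; have sUA b : b \in U -> b \in A by apply: (subvP UA).
apply: (small_abelian_idealI dL (J := (U + W)%VS)).
- apply/idealP => v _ /memv_addP[b bU [w wW ->]]; have [c cA [w' w'W ->]] := splitW v.
  have [bw' w'b] := UW _ _ bU w'W; have bA := sUA b bU.
  rewrite !brE (abA cA bA) (abA bA cA) bw' w'b (WW _ _ w'W wW) (WW _ _ wW w'W) !addr0 !add0r.
  by split; apply: (subvP (addvSr _ _)); auto.
- apply/abelianP => _ _ /memv_addP[b bU [w wW ->]] /memv_addP[c cU [w' w'W ->]].
  have [bw' _] := UW _ _ bU w'W; have [_ wc] := UW _ _ cU wW.
  by rewrite !brE bw' wc (abA (sUA b bU) (sUA c cU)) WW // !addr0.
- rewrite dimv_disjoint_sum ?dW -?addnA //.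
  by apply/eqP; rewrite -subv0 -capAW capvS.
Qed.

Let codim2A (f : 'End(L)) : (forall b, b \in A -> f b \in W) -> (n <= \dim (A :&: lker f) + 4)%N.
Proof.
by move/codim_cap_lker; rewrite dW -dA => dk; rewrite (addnA _ 2 2) leq_add2r.
Qed.

(** It suffices to find [x] in [W] such that [[br b, x] = 0] forces [b] to kill [W]: the kernel of
    [b |-> [br b, x]] has codimension at most two in [A] and joins [W]. If some [[br a, x]] leaves
    the line of [x], commutation with [a] gives this; otherwise [A] acts on [W] by scalars. *)
Let abelian_complement_case :
  (forall w w', w \in W -> w' \in W -> [br w, w'] = 0) ->
  (forall b, b \in A -> (forall w, w \in W -> [br b, w] = 0) -> forall w, w \in W -> [br w, b] = 0) ->
  small_abelian_ideal L n.
Proof.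
move=> WW lr.
have [x xW xP] : exists2 x, x \in W &
    forall b, b \in A -> [br b, x] = 0 -> forall w, w \in W -> [br b, w] = 0.
  have [[a [x [aA [xW /negP axx]]]] | nex] :=
      classic (exists a x, a \in A /\ (x \in W /\ ~ [br a, x] \in <[x]>%VS)).
    exists x => // b bA bx w wW.
    have x0 : x != 0 by apply: contraNneq axx => ->; rewrite br0r mem0v.
    have axW := lW aA xW.
    have fr : free2 A x [br a, x].
      move=> s t stA; have st0 := WA (memvD (memvZ s xW) (memvZ t axW)) stA.
      have t0 : t = 0.
        apply: (scaleK0 _ axx); apply: (memv_eq (memv_opp (memvZ s (memv_line x)))).
        by apply/eqP; rewrite -addr_eq0 addrC st0.
      split=> //; move/eqP: st0; rewrite t0 scale0r addr0 scaler_eq0 (negPf x0) orbF.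
      by move/eqP.
    have [s [t ->]] := spanW xW axW fr wW.
    by rewrite !brE (br_ll abA) // bx br0r !scaler0 addr0.
  have eig b w : b \in A -> w \in W -> exists k, [br b, w] = k *: w.
    move=> bA wW; apply/vlineP/negPn/negP => /negP bw.
    by apply: nex; exists b, w.
  have [x [y [xW yW fr]]] := exW; exists x => // b bA bx w wW.
  have [s [t ->]] := spanW xW yW fr wW; have [k byE] := eig b y bA yW.
  have [l bxyE] := eig b (x + y) bA (memvD xW yW).
  rewrite brDr bx byE add0r scalerDr in bxyE.
  case: (@fr0 x y (- l) (k - l)) => //; last first.
    by move/eqP; rewrite oppr_eq0 => /eqP l0; rewrite l0 subr0 => k0; rewrite !brE bx byE k0 scale0r !scaler0 addr0.
  by apply: (lincomb1 (a := 1) bxyE); vring.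
apply: (small_abelian_sum (U := A :&: lker (ad_r x))) => //.
- exact: capvSl.
- by apply: codim2A => b bA; rewrite ad_rE lW.
move=> b w; rewrite memv_cap memv_ker ad_rE => /andP[bA /eqP bx] wW.
by have bW := xP b bA bx; rewrite bW ?lr.
Qed.

(** * Right action of [A] on [W] opposite to the left one *)

Section Skew.
Hypothesis skewA : forall b w, b \in A -> w \in W -> [br w, b] = - [br b, w].

(** With [w = [br a0, v]], the elements [v], [w'] and [[br v, w']] all have right products with [a0]
    opposite to the left ones; the Leibniz identity for [v, w', a0] then leaves skew symmetry. *)
Lemma skewW w w' : w \in W -> w' \in W -> [br w, w'] = - [br w', w].
Proof.
case/surjW => v vW ->{w} w'W; have [a aA [u uW E]] := splitW [br v, w'].
have vwa : [br [br v, w'], a0] = - [br a0, [br v, w']].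
  by rewrite E !brE (abA aA a0A) (abA a0A aA) skewA // !add0r.
have := leib v w' a0; rewrite vwa (leib a0 v) (skewA a0A w'W) (skewA a0A vW) !brNr => e.
by apply: (lincomb1 (a := 1) e); vring.
Qed.

Lemma skew_sqW w : w \in W -> [br w, w] = 0.
Proof.
by move=> wW; apply: (add_self_eq0 two0); rewrite {1}(skewW wW wW) addrC subrr.
Qed.

Variables x y : L.
Hypotheses (xW : x \in W) (yW : y \in W) (fr : free2 A x y).
Variables p q r : F.
Hypotheses (a0x : [br a0, x] = p *: x + q *: y) (a0y : [br a0, y] = r *: x - p *: y).
Hypotheses (k0 : p ^+ 2 + q * r != 0) (c0 : [br x, y] != 0) (cA : [br x, y] \in A).

Let A0 := (A :&: (lker (ad_r x) :&: lker (ad_r y)))%VS.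
Let A0P b : reflect [/\ b \in A, [br b, x] = 0 & [br b, y] = 0] (b \in A0).
Proof.
rewrite !memv_cap !memv_ker !ad_rE.
by apply: (iffP and3P) => -[bA bx by_]; split=> //; apply/eqP.
Qed.
Let A0A : (A0 <= A)%VS. Proof. exact: capvSl. Qed.

Let A0W b w : b \in A0 -> w \in W -> [br b, w] = 0 /\ [br w, b] = 0.
Proof.
case/A0P => bA bx by_ wW; rewrite (skewA bA wW); have [s [t ->]] := spanW xW yW fr wW.
by rewrite !brE bx by_ !scaler0 addr0 oppr0.
Qed.

(** Since [b] kills [[br x, y]], it is traceless on [W]; a traceless map of a plane commuting with
    the invertible traceless [a0] is a multiple of it in characteristic other than two. *)
Let A0_span b : b \in A -> exists t, b - t *: a0 \in A0.
Proof.
move=> bA; have [s [t bx]] := spanW xW yW fr (lW bA xW).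
have [s' [t' byE]] := spanW xW yW fr (lW bA yW).
have tr : t' = - s.
  have e := leib b x y; rewrite (abA bA cA) bx byE !brE (skew_sqW xW) (skew_sqW yW) in e.
  apply/eqP; rewrite -addr_eq0 addrC; apply: contraNT c0 => st.
  rewrite -(inj_eq (scalerI st)) scaler0; apply/eqP.
  by apply: (lincomb1 (a := -1) e); vring.
have e1 := br_ll abA x a0A bA; rewrite a0x bx !brE a0x a0y bx byE tr in e1.
have e2 := br_ll abA y a0A bA; rewrite a0y byE !brE a0x a0y bx byE tr in e2.
case: (@fr0 x y (t * r - q * s') (2%:R * (q * s - p * t)) fr).
  by apply: (lincomb1 (a := 1) e1); vring.
move=> /eqP; rewrite subr_eq0 => /eqP E1 /eqP; rewrite mulf_eq0 (negPf two0) subr_eq0 => /eqP E2.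
case: (@fr0 x y (2%:R * (p * s' - r * s)) (q * s' - t * r) fr).
  by apply: (lincomb1 (a := 1) e2); vring.
move=> /eqP; rewrite mulf_eq0 (negPf two0) subr_eq0 => /eqP E3 _.
(* On [W] the factor is [tr(a0 b) / tr(a0 a0)], with a two cancelled by means of [E1]. *)
have quot k l : (p * s + q * s') * k = l * (p ^+ 2 + q * r) ->
    (p * s + q * s') / (p ^+ 2 + q * r) * k = l.
  by move=> e; rewrite mulrAC; apply: canLR (mulfK k0) e.
have tp : (p * s + q * s') / (p ^+ 2 + q * r) * p = s.
  by apply: quot; rewrite mulrDl -mulrA -(mulrA q) (mulrC s') E3; ring.
have tq : (p * s + q * s') / (p ^+ 2 + q * r) * q = t.
  by apply: quot; rewrite mulrDl -mulrA -(mulrA q) (mulrC s) E2 (mulrC s') -E1; ring.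
have tr' : (p * s + q * s') / (p ^+ 2 + q * r) * r = s'.
  by apply: quot; rewrite mulrDl -!mulrA (mulrC s) -E3; ring.
exists ((p * s + q * s') / (p ^+ 2 + q * r)); apply/A0P; split.
- by memv_auto.
- by rewrite !brE a0x bx scalerDr !scalerA tp tq subrr.
- by rewrite !brE a0y byE tr scalerBr !scalerA tr' tp; vring.
Qed.

Let a0A0 : a0 \notin A0.
Proof.
apply/negP => /A0P[_]; rewrite a0x a0y => /(fr0 fr)[p0 q0] _.
by case/eqP: k0; rewrite p0 q0 mul0r addr0 expr0n.
Qed.

Let dimA0 : (\dim A0 + 3 = n)%N.
Proof.
have AE : A = (A0 + <[a0]>)%VS.
  apply/eqP; rewrite eqEsubv subv_add A0A -memvE a0A !andbT.
  by apply/subvP => b /A0_span[t bt]; apply/memv_add_lineP; exists t.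
by rewrite -dA AE dim_add_line // addSnnS.
Qed.

(** The products of [W] lie on the line of [[br x, y]], inside [A0], so [A0 + W] is the Heisenberg
    part, with outer element [a0]. *)
Let skew_heisenberg : [br x, y] \in A0 -> small_abelian_ideal L n \/ heisenberg_case L n.
Proof.
move=> cA0; have cap0 : (A0 :&: W = 0)%VS by apply/eqP; rewrite -subv0 -capAW capvS.
have sAW b : b \in A0 -> b \in (A0 + W)%VS by apply: subvP; apply: addvSl.
have sWW w : w \in W -> w \in (A0 + W)%VS by apply: subvP; apply: addvSr.
apply: (@heisenberg_or_small _ _ _ (A0 + W)%VS A0 a0) => //.
- by rewrite dimv_disjoint_sum // dW -addnA.
- exact: addvSl.
- apply/memv_addP => -[b bA0 [w wW E]]; case/negP: a0A0; rewrite E.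
  have bA := subvP A0A _ bA0; rewrite (WA wW) ?addr0 //.
  by apply: (memv_eq (memvB a0A bA)); rewrite E; vring.
- move=> z _ zA0 /memv_addP[b bA0 [w wW ->]]; have [zw wz] := A0W zA0 wW.
  have [zA bA] := (subvP A0A _ zA0, subvP A0A _ bA0).
  by rewrite !brE zw wz (abA zA bA) (abA bA zA) addr0.
- move=> _ _ /memv_addP[b bA0 [w wW ->]] /memv_addP[b' b'A0 [w' w'W ->]].
  have [bA b'A] := (subvP A0A _ bA0, subvP A0A _ b'A0).
  have [bw' _] := A0W bA0 w'W; have [_ wb'] := A0W b'A0 wW.
  rewrite !brE (abA bA b'A) bw' wb' !add0r.
  have [s [t ->]] := spanW xW yW fr wW; have [s' [t' ->]] := spanW xW yW fr w'W.
  by rewrite !brE (skew_sqW xW) (skew_sqW yW) (skewW yW xW); memv_auto.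
- move=> _ /memv_addP[b bA0 [w wW ->]]; have [bw wb] := A0W bA0 wW.
  have bA := subvP A0A _ bA0.
  by rewrite !brE bw wb (abA bA bA) (skew_sqW wW) !addr0.
- move=> _ /memv_addP[b bA0 [w wW ->]]; have bA := subvP A0A _ bA0.
  by rewrite brDr (abA a0A bA) add0r; apply/sWW/lW.
- by move=> z /(subvP A0A) zA; rewrite (abA a0A zA) mem0v.
- move=> _ /memv_addP[b bA0 [w wW ->]]; have bA := subvP A0A _ bA0.
  by rewrite !brE (skewA a0A wW) (abA a0A bA) (abA bA a0A) !add0r subrr mem0v.
- by rewrite (abA a0A a0A) mem0v.
Qed.

(** Modulo [A0], [[br x, y]] is a non-zero multiple of [a0]; it acts invertibly on [W] and plays the
    role of [h]. *)
Let skew_simple : [br x, y] \notin A0 -> simple_case L n.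
Proof.
move=> cA0; have [t ct] := A0_span cA.
have t0 : t != 0 by apply: contraNneq cA0 => t0; rewrite t0 scale0r subr0 in ct.
have /A0P[_ cx cy] := ct.
have hx : [br [br x, y], x] = (t * p) *: x + (t * q) *: y.
  by apply: (lincomb1 (a := 1) cx); rewrite !brE a0x; vring.
have hy : [br [br x, y], y] = (t * r) *: x - (t * p) *: y.
  by apply: (lincomb1 (a := 1) cy); rewrite !brE a0y; vring.
apply: (@simple_caseI _ _ _ (t * p) (t * q) (t * r) [br x, y] x y A0 _ dL dimA0).
  split.
  - by split; [exact: hx | rewrite (skewA cA xW) hx].
  - by split; [exact: hy | rewrite (skewA cA yW) hy].
  - by split; [by [] | exact: skewW].
  - by split; [exact: abA | exact: skew_sqW | exact: skew_sqW].
  split=> //; have -> : (t * p) ^+ 2 + t * q * (t * r) = t ^+ 2 * (p ^+ 2 + q * r) by ring.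
  by rewrite mulf_neq0 ?expf_neq0.
move=> b bA0 v; have [a aA [w wW ->]] := splitW v; have [bw wb] := A0W bA0 wW.
have bA := subvP A0A _ bA0.
by rewrite !brE bw wb (abA aA bA) (abA bA aA) addr0.
Qed.

Lemma skew_trace_zero : small_abelian_ideal L n \/ (simple_case L n \/ heisenberg_case L n).
Proof.
have [/skew_heisenberg[]|/skew_simple] := boolP ([br x, y] \in A0); tauto.
Qed.

End Skew.

(** [a0] multiplies [[br x, y]] by its trace on [W]. If the trace is non-zero, the product lies in
    [W], and an eigenvector for the trace would leave eigenvalue zero to an invertible map, so the
    product vanishes. A non-zero product thus lies in [A], with trace zero. *)
Let skew_case : (forall b w, b \in A -> w \in W -> [br w, b] = - [br b, w]) ->
  small_abelian_ideal L n \/ (simple_case L n \/ heisenberg_case L n).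
Proof.
move=> skewA; have [x [y [xW yW fr]]] := exW.
have [p [q a0x]] := spanW xW yW fr (lW a0A xW).
have [r [s a0y]] := spanW xW yW fr (lW a0A yW).
have det0 : p * s - q * r != 0.
  apply/eqP => d0.
  have k1 : s *: x - q *: y = 0.
    apply: injW; first by memv_auto.
    have -> : [br a0, s *: x - q *: y] = (p * s - q * r) *: x by rewrite !brE a0x a0y; vring.
    by rewrite d0 scale0r.
  have k2 : r *: x - p *: y = 0.
    apply: injW; first by memv_auto.
    have -> : [br a0, r *: x - p *: y] = - (p * s - q * r) *: y by rewrite !brE a0x a0y; vring.
    by rewrite d0 oppr0 scale0r.
  rewrite -scaleNr in k1; rewrite -scaleNr in k2.
  have [_ /eqP] := fr0 fr k1; have [_ /eqP] := fr0 fr k2.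
  rewrite !oppr_eq0 => /eqP p0 /eqP q0; rewrite p0 q0 !scale0r addr0 in a0x.
  have x0 := injW xW a0x; have [|/eqP] := fr 1 0.
    by rewrite x0 scaler0 scale0r addr0 mem0v.
  by rewrite oner_eq0.
have a0c : [br a0, [br x, y]] = (p + s) *: [br x, y].
  rewrite leib a0x a0y !brE.
  by rewrite (skew_sqW skewA xW) (skew_sqW skewA yW); vring.
have cA : [br x, y] \in A.
  have [ps | ps] := eqVneq (p + s) 0.
    by apply: a0inj; rewrite a0c ps scale0r mem0v.
  have cW : [br x, y] \in W by rewrite -(memv_scaleE _ _ ps) -a0c memW.
  have [k [l cE]] := spanW xW yW fr cW.
  have e := a0c; rewrite {1}cE !brE a0x a0y cE in e.
  have [|kE lE] := @fr0 x y (l * r - k * s) (k * q - l * p) fr.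
    by apply: (lincomb1 (a := 1) e); vring.
  have k0 : k = 0.
    apply: (mulIf det0); rewrite mul0r.
    rewrite (_ : _ * _ = - p * (l * r - k * s) - r * (k * q - l * p)); last by ring.
    by rewrite kE lE !mulr0 subrr.
  have l0 : l = 0.
    apply: (mulIf det0); rewrite mul0r.
    rewrite (_ : _ * _ = - q * (l * r - k * s) - s * (k * q - l * p)); last by ring.
    by rewrite kE lE !mulr0 subrr.
  by rewrite cE k0 l0 !scale0r addr0 mem0v.
have [c0 | c0] := eqVneq [br x, y] 0.
  left; apply: abelian_complement_case => [w w' wW w'W | b bA bW w wW]; last first.
    by rewrite skewA // bW ?oppr0.
  have [k [l ->]] := spanW xW yW fr wW; have [k' [l' ->]] := spanW xW yW fr w'W.
  by rewrite !brE (skewW skewA yW xW) c0 (skew_sqW skewA xW) (skew_sqW skewA yW); vring.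
have sp0 : s = - p.
  apply/eqP; rewrite -addr_eq0 addrC; move/eqP: a0c.
  by rewrite (abA a0A cA) eq_sym scaler_eq0 (negPf c0) orbF.
rewrite sp0 scaleNr in a0y; apply: (skew_trace_zero skewA xW yW fr a0x a0y _ c0 cA).
by rewrite -oppr_eq0 (_ : - _ = p * s - q * r) // sp0; ring.
Qed.

(** * A line of [W] annihilating [L] from the left *)

Section LeftKernel.
Variables w0 w2 v2 : L.
Hypotheses (w0W : w0 \in W) (w0l : forall v, [br w0, v] = 0) (w00 : w0 != 0).
Hypotheses (w2W : w2 \in W) (w2v2 : [br w2, v2] != 0).

Let left_kernel w : w \in W -> (forall v, [br w, v] = 0) -> exists k, w = k *: w0.
Proof.
have fr : free2 A w0 w2.
  move=> s t stA; have st0 := WA (memvD (memvZ s w0W) (memvZ t w2W)) stA.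
  have t0 : t = 0.
    have := congr1 (fun v => [br v, v2]) st0; rewrite !brE w0l scaler0 add0r => /eqP.
    by rewrite scaler_eq0 (negPf w2v2) orbF => /eqP.
  split=> //; move/eqP: st0; rewrite t0 scale0r addr0 scaler_eq0 (negPf w00) orbF.
  by move/eqP.
move=> wW wl; have [s [t E]] := spanW w0W w2W fr wW; exists s; rewrite E.
have := wl v2; rewrite E !brE w0l scaler0 add0r => /eqP.
by rewrite scaler_eq0 (negPf w2v2) orbF => /eqP->; rewrite scale0r addr0.
Qed.

Let br_left_kernel (w v z : L) : (forall u : L, [br w, u] = 0) -> [br [br v, w], z] = 0.
Proof. by move=> wl; rewrite leib_l !wl br0r subrr. Qed.

Let eig0 b : b \in A -> exists k, [br b, w0] = k *: w0.
Proof. by move=> bA; apply: left_kernel => [|v]; [apply: lW | apply: br_left_kernel]. Qed.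

(** [A] acts diagonally from the left on a basis [w0, w1] of [W]. If [[br w1, w0]] and [[br w1, w1]]
    vanish, [W] is abelian and is enlarged by a subspace of [A]; otherwise the left annihilator of
    [w1] in [A] also kills [w0], and together they form the ideal. *)
Lemma left_kernel_case : small_abelian_ideal L n.
Proof.
have [w [wW waN]] : exists w, w \in W /\ [br w, a0] <> 0.
  (* If [a0] annihilated [W] from the right, all [[br a0, w']] would annihilate [L] from the left;
     they fill [W], [w2] included. *)
  apply: NNPP => nex; case/eqP: w2v2; case/surjW: w2W => w' w'W ->.
  have := br_symm_kill w' a0 v2; suff -> : [br w', a0] = 0 by rewrite add0r.
  by apply: NNPP => ne; apply: nex; exists w'.
have [w1 w1E] : exists w1, w1 = [br w, a0] by exists [br w, a0].
have w1W : w1 \in W by rewrite w1E rW.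
have w10 : w1 != 0 by rewrite w1E; apply/eqP.
have w1a0 : [br w1, a0] = - [br a0, w1] by rewrite w1E (br_rr abA).
have a0w1 : [br a0, w1] != 0 by apply: contraNneq w10 => /(injW w1W)->.
have fr : free2 A w0 w1.
  move=> s t stA; have st0 := WA (memvD (memvZ s w0W) (memvZ t w1W)) stA.
  have t0 : t = 0.
    have := congr1 (fun v => [br v, a0]) st0; rewrite !brE w0l scaler0 add0r w1a0 => /eqP.
    by rewrite scalerN oppr_eq0 scaler_eq0 (negPf a0w1) orbF => /eqP.
  split=> //; move/eqP: st0; rewrite t0 scale0r addr0 scaler_eq0 (negPf w00) orbF.
  by move/eqP.
have [l0 l0E] := eig0 a0A.
have l00 : l0 != 0.
  by apply: contraNneq w00 => l00; apply/eqP; apply: injW => //; rewrite l0E l00 scale0r.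
have eig1 b : b \in A -> exists k, [br b, w1] = k *: w1.
  move=> bA; have [k [l E]] := spanW w0W w1W fr (lW bA w1W); exists l.
  (* Right multiplication by [a0] kills [w0], is opposite to the left one at [w1] and commutes with
     [b]; this forces [k * l0 = 0]. *)
  have e := br_lr abA w1 bA a0A; rewrite w1a0 brNr (br_ll abA) // E !brE l0E w0l w1a0 in e.
  have : (k * l0) *: w0 = 0 by apply: (lincomb1 (a := -1) e); vring.
  move/eqP; rewrite scaler_eq0 (negPf w00) orbF mulf_eq0 (negPf l00) orbF => /eqP k0.
  by rewrite E k0 scale0r add0r.
have [l1 l1E] := eig1 a0 a0A.
have l10 : l1 != 0 by apply: contraNneq a0w1 => l10; rewrite l1E l10 scale0r.
have w1r b : b \in A -> exists k, [br w1, b] = k *: w0 - [br b, w1].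
  move=> bA; have [||k E] := @left_kernel ([br w1, b] + [br b, w1]).
  - exact: memvD (rW bA w1W) (lW bA w1W).
  - by move=> v; apply: br_symm_kill.
  - by exists k; rewrite -E addrK.
have [c w11] : exists c : F, [br w1, w1] = c *: w0.
  apply: left_kernel => [|v]; last exact: br_sq_kill.
  have tl : 2%:R * l1 != 0 by rewrite mulf_neq0.
  rewrite -(memv_scaleE _ _ tl); apply: (memv_eq (memW [br w1, w1])).
  by rewrite leib l1E !brE; vring.
have [d dE] : exists d, [br w1, w0] = d by exists [br w1, w0].
have dl v : [br d, v] = 0 by rewrite -dE; apply: br_left_kernel.
have adE b k0 k1 : [br b, w0] = k0 *: w0 -> [br b, w1] = k1 *: w1 ->
    [br b, d] = (k1 + k0) *: d.
  by move=> E0 E1; rewrite -dE leib E0 E1 !brE; vring.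
have dA' : d \in A.
  (* An eigenvector of [a0] lies in [A] for eigenvalue zero and in [W] otherwise. In [W], [d] would
     be a multiple of [w0], of eigenvalue [l0], so it vanishes as [l1] is non-zero. *)
  have a0d := adE _ _ _ l0E l1E; have [l01 | l01] := eqVneq (l1 + l0) 0.
    by apply: a0inj; rewrite a0d l01 scale0r mem0v.
  have dW' : d \in W by rewrite -(memv_scaleE _ _ l01) -a0d memW.
  have [k kE] := left_kernel dW' dl; rewrite kE !brE l0E in a0d.
  have : (l1 * k) *: w0 = 0 by apply: (lincomb1 (a := -1) a0d); vring.
  move/eqP; rewrite scaler_eq0 (negPf w00) orbF mulf_eq0 (negPf l10) => /eqP k0.
  by rewrite kE k0 scale0r mem0v.
have [/andP[/eqP d0 /eqP c0] | dc0] := boolP ((d == 0) && (c == 0)).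
  have WW w' w'' : w' \in W -> w'' \in W -> [br w', w''] = 0.
    move=> /(spanW w0W w1W fr)[k [l ->]] /(spanW w0W w1W fr)[k' [l' ->]].
    by rewrite !brE !w0l dE d0 w11 c0 scale0r !scaler0 !addr0.
  have [/not_all_ex_not[b nb] | sk] := classic (~ forall b, b \in A -> [br w1, b] = - [br b, w1]).
    have bA : b \in A by apply/negPn/negP => /negP bA; apply: nb => /bA.
    have [k E] := w1r b bA; have k0 : k != 0.
      by apply/eqP => k0; apply: nb => _; rewrite E k0 scale0r sub0r.
    apply: (small_abelian_sum (U := A :&: lker (ad_l w1))) => //.
    - exact: capvSl.
    - by apply: codim2A => b' b'A; rewrite ad_lE rW.
    move=> b' w'; rewrite memv_cap memv_ker ad_lE => /andP[b'A /eqP w1b'].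
    have [m b'w0] := eig0 b'A; have [m' b'w1] := eig1 b' b'A.
    have m'0 : m' = 0.
      have [j E'] := w1r b' b'A; rewrite w1b' b'w1 in E'.
      have [|_ /eqP] := @fr0 w0 w1 j (- m') fr; last by rewrite oppr_eq0 => /eqP.
      by rewrite E' scaleNr.
    have m0 : m = 0.
      have [j bw1] := eig1 b bA; have e := br_lr abA w1 b'A bA.
      rewrite E b'w1 m'0 scale0r br0l bw1 !brE b'w0 b'w1 m'0 in e.
      have : (k * m) *: w0 = 0 by apply: (lincomb1 (a := 1) e); vring.
      by move/eqP; rewrite scaler_eq0 (negPf w00) orbF mulf_eq0 (negPf k0) => /eqP.
    move=> /(spanW w0W w1W fr)[k1 [k2 ->]].
    by rewrite !brE w0l w1b' b'w0 b'w1 m0 m'0 !scale0r !scaler0 addr0.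
  apply: abelian_complement_case => // b bA bW _ /(spanW w0W w1W fr)[k [l ->]].
  by rewrite !brE w0l (NNPP _ sk b bA) bW // oppr0 !scaler0 addr0.
have A0w0 b : b \in A -> [br b, w1] = 0 -> [br b, w0] = 0.
  (* If [d] is non-zero, [b] acts on it as on [w0], hence by zero since both lie in [A]. Otherwise
     [c] is non-zero and [w0] is a multiple of [[br w1, w1]], which [b] kills. *)
  move=> bA bw1; have [m bw0] := eig0 bA; have bw1' : [br b, w1] = 0 *: w1 by rewrite bw1 scale0r.
  have := adE _ _ _ bw0 bw1'; rewrite (abA bA dA') add0r => /esym/eqP.
  rewrite scaler_eq0 => /orP[/eqP m0 | d0]; first by rewrite bw0 m0 scale0r.
  rewrite d0 /= in dc0; have := leib b w1 w1; rewrite bw1 br0l br0r addr0 w11 brZr => /eqP.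
  by rewrite scaler_eq0 (negPf dc0) => /eqP.
pose A0 := (A :&: lker (ad_r w1))%VS.
have A0P b : reflect (b \in A /\ [br b, w1] = 0) (b \in A0).
  by rewrite memv_cap memv_ker ad_rE; apply: (iffP andP) => -[bA /eqP].
apply: (small_abelian_line dL abA (spanA dL dA fr) (U := A0) (z := w0)) => //.
- exact: capvSl.
- by apply: contra w00 => /A0P[/(WA w0W)-> _].
- by apply: (dim_lker_line dA (x := w1)) => b bA; have [k E] := eig1 b bA; exists k; rewrite ad_rE.
- by move=> b /A0P[bA bw1]; rewrite w0l A0w0 // mem0v.
- move=> b /A0P[bA bw1]; have [k ->] := w1r b bA; rewrite bw1 subr0 mem0v.
  by split; memv_auto.
- by move=> b bA; have [k ->] := eig0 bA; rewrite w0l mem0v; split; memv_auto.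
- by rewrite w0l mem0v.
- rewrite w0l dE mem0v; split=> //; apply/mem_addl/A0P; split=> //.
- by move=> b /A0P[bA bw1]; rewrite w0l A0w0.
Qed.

End LeftKernel.

(** Opposite actions need testing only for [a0]: then [[br w, b] + [br b, w]], which annihilates
    [a0] from the left, is also killed by the injective left action of [a0]. A failure at [w] makes
    [[br w, a0] + [br a0, w]] a non-zero left annihilator. *)
Lemma nonsingular_case : small_abelian_ideal L n \/ (simple_case L n \/ heisenberg_case L n).
Proof.
have [skew0 | /not_all_ex_not[w nw]] :=
    classic (forall w, w \in W -> [br w, a0] = - [br a0, w]).
  apply: skew_case => b w bA wW; apply/eqP; rewrite -addr_eq0; apply/eqP.
  have bwW : [br w, b] + [br b, w] \in W by exact: memvD (rW bA wW) (lW bA wW).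
  apply: injW => //; apply: oppr_inj; rewrite -skew0 // oppr0.
  exact: br_symm_kill.
have wW : w \in W by apply/negPn/negP => /negP wW; apply: nw => /wW.
left; have [Wl | nWl] := classic (forall w, w \in W -> forall v, [br w, v] = 0).
  by apply: abelian_complement_case => [w' w'' /Wl-> // | b bA _ w' /Wl->].
have [w2 [w2W [v2 w2v2]]] : exists w2, w2 \in W /\ exists v2, [br w2, v2] <> 0.
  apply: NNPP => nex; apply: nWl => w2 w2W v2; apply: NNPP => ne.
  by apply: nex; exists w2; split=> //; exists v2.
apply: (@left_kernel_case ([br w, a0] + [br a0, w]) w2 v2) => //.
- exact: memvD (rW a0A wW) (lW a0A wW).
- by move=> v; apply: br_symm_kill.
- by apply/eqP => e; apply: nw => _; apply/eqP; rewrite -addr_eq0 e.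
- exact/eqP.
Qed.

End NonSingular.

Theorem theorem1 (F : fieldType) (hF : 2%N \notin [pchar F])
    (L : leibnizType F) (n : nat) (hn : \dim {:L} = n)
    (hA : exists A : {vspace L},
        [/\ subalgebra A, abelian A & (\dim A + 2 = n)%N]) :
  (solvable L /\
   exists (I : {vspace L}) (k : nat),
     [/\ abelian_ideal I, (\dim I + k = n)%N & (k <= 2)%N])
  \/
  [\/ (is_lie L /\ step_solvable L 3) /\
      exists (m : 'M[F]_2)
             (f : 'Hom((c_alg m * abelian_alg F (n - 4))%type, L)),
        [/\ \tr m = 0 /\ irreducible_mx m,
            is_alg_iso f,
            isomorphic (subvs_of (derived L 1)) (heisenberg F),
            (let Z := (f @: limg (linfun (@dsum_inr F (c_alg m) (abelian_alg F (n - 4)))))%VS in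
             (Z :&: derived L 2 = 0)%VS /\ center L = (Z + derived L 2)%VS) &
            unique_max_abelian_ideal (center L) /\ \dim (center L) = (n - 3)%N],

      (is_lie L /\ almost_simple L) /\
      exists m : 'M[F]_2,
        [/\ \tr m = 0 /\ simple_lie (d_alg m),
            isomorphic L (d_alg m * abelian_alg F (n - 3))%type,
            isomorphic (subvs_of (center L)) (abelian_alg F (n - 3)) &
            unique_max_abelian_ideal (center L) /\ \dim (center L) = (n - 3)%N]

    | step_solvable L 3 /\
      exists B : {vspace L},
        [/\ is_nilradical B,
            isomorphic (subvs_of B) (heisenberg F * abelian_alg F (n - 4))%type,
            (exists (phi theta : 'End(subvs_of B)) (v : subvs_of B)
                    (g : 'Hom(ext_alg phi theta v, L)),
               [/\ v \in center (subvs_of B) /\ in_leibniz_kernel (vsval v),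
                   left_derivation phi,
                   is_alg_iso g /\ (forall b : subvs_of B, g (0, b) = vsval b) &
                   exists phiq thetaq : 'End(quotv (center (subvs_of B))),
                     [/\ induces phi phiq, induces theta thetaq,
                         phiq = - thetaq & irreducible_map phiq]]) &
            (let CB := (linfun vsval @: center (subvs_of B))%VS in
             unique_max_abelian_ideal CB /\ \dim CB = (n - 3)%N)]].
Proof.
have two0 : (2%:R : F) != 0 by move: hF; rewrite inE.
have [A [_ /abelianP abA dA]] := hA.
have cases : small_abelian_ideal L n \/ (simple_case L n \/ heisenberg_case L n).
  have [sing | nsing] := classic (left_singular A); first exact: singular_case sing.
  have [a [aA ainj]] : exists a, a \in A /\ forall v, [br a, v] \in A -> v \in A.
    apply: NNPP => nex; apply: nsing => a aA; apply: NNPP => nv; apply: nex; exists a.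
    by split=> // v avA; apply/negPn/negP => vA; apply: nv; exists v.
  exact: (nonsingular_case two0 hn dA abA aA ainj).
case: cases => [? | [? | ?]]; [by left | right; exact: Or32 | right; exact: Or33].
Qed.
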